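(* If $V=L$ and $\kappa$ is unfoldable, then for all $m$ and $n$, $\kappa$ is $\Pi^n_m$-indescribable.
   Context: $\mathcal{R}(\kappa)=V_\kappa$ is the set of all sets of rank less than $\kappa$. For structures $\mathfrak{A}=(M,E,\dots)$ and $\mathfrak{B}=(N,F,\dots)$ in the same language, $\mathfrak{B}$ is an end elementary extension (eee) of $\mathfrak{A}$, written $\mathfrak{A}\prec_e\mathfrak{B}$, if $\mathfrak{B}$ is a proper elementary extension of $\mathfrak{A}$ and for every $a\in M$, $\{b\in M : bEa\}=\{b\in N: bFa\}$. $o(M)$ denotes the ordinal height of $M$. A cardinal $\kappa$ is unfoldable if it is inaccessible and for every ordinal $\alpha$ and every $S\subset\mathcal{R}(\kappa)$ there is a well-founded eee $M$ of $(\mathcal{R}(\kappa),\in,S)$ with $o(M)\geq\alpha$. $m,n$ range over natural numbers; $\kappa$ is $\Pi^n_m$-indescribable if for every $U\subset V_\kappa$ and every $\Pi^n_m$ sentence $\varphi$ (order-$(n+1)$ formulas with $m$ alternating blocks of quantifiers over the highest type, starting with universal) with $(V_\kappa,\in,U)\models\varphi$, there is $\alpha<\kappa$ with $(V_\alpha,\in,U\cap V_\alpha)\models\varphi$. *)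

(* Defs.v *)
Set Implicit Arguments.
Unset Strict Implicit.

(** The universe of sets: a type with a membership relation satisfying the
    axioms of ZFC.  Classes and class functions are arbitrary predicates and
    relations on the type; in particular replacement is for all functional
    relations, and separation and the empty set follow from it. *)

Record membership := Membership {
  carrier :> Type;
  mem : carrier -> carrier -> Prop
}.

Declare Scope sets_scope.
Notation "x ∈ y" := (mem x y) (at level 70, no associativity) : sets_scope.
Notation "x ∉ y" := (~ mem x y) (at level 70, no associativity) : sets_scope.
Open Scope sets_scope.

Definition subset (V : membership) (x y : V) : Prop :=
  forall z, z ∈ x -> z ∈ y.
Notation "x ⊆ y" := (subset x y) (at level 70, no associativity) : sets_scope.

Definition empty (V : membership) (x : V) : Prop := forall z, z ∉ x.

(** [succ x y] : y = x ∪ {x} *)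
Definition succ (V : membership) (x y : V) : Prop :=
  forall z, z ∈ y <-> z ∈ x \/ z = x.

Record ZFC (V : membership) : Prop := {
  ax_extensionality : forall x y : V, (forall z, z ∈ x <-> z ∈ y) -> x = y;
  ax_foundation : forall x : V, ~ empty x ->
    exists y, y ∈ x /\ forall z, z ∈ y -> z ∉ x;
  ax_pairing : forall x y : V, exists p, forall z, z ∈ p <-> z = x \/ z = y;
  ax_union : forall x : V, exists u, forall z,
    z ∈ u <-> exists y, y ∈ x /\ z ∈ y;
  ax_powerset : forall x : V, exists p, forall z, z ∈ p <-> z ⊆ x;
  ax_infinity : exists w : V, (exists e, e ∈ w /\ empty e) /\
    forall x, x ∈ w -> exists y, y ∈ w /\ succ x y;
  ax_replacement : forall (R : V -> V -> Prop) (a : V),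
    (forall x y y', x ∈ a -> R x y -> R x y' -> y = y') ->
    exists b, forall y, y ∈ b <-> exists x, x ∈ a /\ R x y;
  ax_choice : forall a : V,
    (forall x, x ∈ a -> ~ empty x) ->
    (forall x y z, x ∈ a -> y ∈ a -> z ∈ x -> z ∈ y -> x = y) ->
    exists c, forall x, x ∈ a -> exists! z, z ∈ x /\ z ∈ c
}.

(** ** Ordinals, ranks and inaccessible cardinals *)

Definition transitive (V : membership) (x : V) : Prop :=
  forall y, y ∈ x -> y ⊆ x.

Definition ordinal (V : membership) (x : V) : Prop :=
  transitive x /\ forall y, y ∈ x -> transitive y.

Definition limit_ordinal (V : membership) (l : V) : Prop :=
  ordinal l /\ ~ empty l /\ forall x, x ∈ l -> exists y, y ∈ l /\ x ∈ y.

(** [rank_lt a x] : the rank sup {rank y + 1 | y ∈ x} of x is less than the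
    ordinal a, i.e. some b < a is a strict bound of the ranks of the elements
    of x.  So [rank_lt a] is the class of elements of V_a. *)
Inductive rank_lt (V : membership) : V -> V -> Prop :=
| rank_lt_intro a x b :
    b ∈ a -> (forall y, y ∈ x -> rank_lt b y) -> rank_lt a x.

Definition cardinal (V : membership) (k : V) : Prop :=
  ordinal k /\
  forall a, a ∈ k -> ~ exists f : V -> V,
    (forall x, x ∈ k -> f x ∈ a) /\
    (forall x y, x ∈ k -> y ∈ k -> f x = f y -> x = y).

Definition uncountable (V : membership) (k : V) : Prop :=
  ~ exists f : V -> nat, forall x y, x ∈ k -> y ∈ k -> f x = f y -> x = y.

Definition regular (V : membership) (k : V) : Prop :=
  forall (a : V) (f : V -> V), a ∈ k -> (forall x, x ∈ a -> f x ∈ k) ->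
  exists b, b ∈ k /\ forall x, x ∈ a -> f x ∈ b.

(** 2^|a| < k for every a < k *)
Definition strong_limit (V : membership) (k : V) : Prop :=
  forall a, a ∈ k -> exists (b : V) (f : V -> V), b ∈ k /\
    (forall x, x ⊆ a -> f x ∈ b) /\
    (forall x y, x ⊆ a -> y ⊆ a -> f x = f y -> x = y).

Definition inaccessible (V : membership) (k : V) : Prop :=
  cardinal k /\ uncountable k /\ regular k /\ strong_limit k.

(** ** Formulas of finite order in the language (∈, U)

    Variables are pairs (t, i) of a type t and an index i.  Over a structure
    with domain D, variables of type 0 range over D and variables of type
    t + 1 over sets of objects of type t.  A formula of order n + 1 only uses
    variables of types 0, ..., n. *)

Inductive form : Type :=
| Bot : form
| Rel : nat -> nat -> form          (* x_i E x_j, both of type 0 *)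
| Pred : nat -> form                (* U(x_i), with x_i of type 0 *)
| Eq : nat -> nat -> nat -> form    (* [Eq t i j] : both of type t *)
| In : nat -> nat -> nat -> form    (* [In t i j] : i of type t, j of type t+1 *)
| Imp : form -> form -> form
| All : nat -> nat -> form -> form  (* [All t i p] binds (t, i) *)
| Ex : nat -> nat -> form -> form.

Record structure (V : membership) := Structure {
  dom : V -> Prop;
  rel : V -> V -> Prop;
  pred : V -> Prop
}.

Fixpoint object (V : membership) (D : V -> Prop) (t : nat) (x : V) : Prop :=
  match t with
  | 0 => D x
  | S t' => forall y, y ∈ x -> object D t' y
  end.

Definition update (V : membership) (r : nat -> nat -> V) (t i : nat) (x : V)
  : nat -> nat -> V :=
  fun s j => if andb (Nat.eqb s t) (Nat.eqb j i) then x else r s j.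

Fixpoint sat (V : membership) (A : structure V) (r : nat -> nat -> V)
  (p : form) : Prop :=
  match p with
  | Bot => False
  | Rel i j => rel A (r 0 i) (r 0 j)
  | Pred i => pred A (r 0 i)
  | Eq t i j => r t i = r t j
  | In t i j => r t i ∈ r (S t) j
  | Imp q q' => sat A r q -> sat A r q'
  | All t i q => forall x, object (dom A) t x -> sat A (update r t i x) q
  | Ex t i q => exists x, object (dom A) t x /\ sat A (update r t i x) q
  end.

Fixpoint free (t i : nat) (p : form) : Prop :=
  match p with
  | Bot => False
  | Rel j k => t = 0 /\ (i = j \/ i = k)
  | Pred j => t = 0 /\ i = j
  | Eq s j k => t = s /\ (i = j \/ i = k)
  | In s j k => (t = s /\ i = j) \/ (t = S s /\ i = k)
  | Imp q q' => free t i q \/ free t i q'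
  | All s j q | Ex s j q => free t i q /\ ~ (t = s /\ i = j)
  end.

Definition sentence (p : form) : Prop := forall t i, ~ free t i p.

(** The assignment is irrelevant for sentences. *)
Definition models (V : membership) (A : structure V) (p : form) : Prop :=
  forall r, sat A r p.

(** All variables, free or bound, have type < n. *)
Fixpoint has_order (n : nat) (p : form) : Prop :=
  match p with
  | Bot => True
  | Rel _ _ | Pred _ => 0 < n
  | Eq t _ _ => t < n
  | In t _ _ => S t < n
  | Imp q q' => has_order n q /\ has_order n q'
  | All t _ q | Ex t _ q => t < n /\ has_order n q
  end.

Definition first_order (p : form) : Prop := has_order 1 p.

Fixpoint quantifiers_below (n : nat) (p : form) : Prop :=
  match p with
  | Bot | Rel _ _ | Pred _ | Eq _ _ _ | In _ _ _ => True
  | Imp q q' => quantifiers_below n q /\ quantifiers_below n q'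
  | All t _ q | Ex t _ q => t < n /\ quantifiers_below n q
  end.

(** [is_Pi n m p] : p is Π^n_m, that is, a formula of order n + 1 consisting of
    m alternating blocks of quantifiers of the highest type n, the first one
    universal, followed by a formula whose quantifiers have types < n. *)
Inductive is_Pi (n : nat) : nat -> form -> Prop :=
| Pi_zero p : has_order (S n) p -> quantifiers_below n p -> is_Pi n 0 p
| Pi_new_block m i p : is_Sigma n m p -> is_Pi n (S m) (All n i p)
| Pi_same_block m i p : is_Pi n (S m) p -> is_Pi n (S m) (All n i p)
with is_Sigma (n : nat) : nat -> form -> Prop :=
| Sigma_zero p : has_order (S n) p -> quantifiers_below n p -> is_Sigma n 0 p
| Sigma_new_block m i p : is_Pi n m p -> is_Sigma n (S m) (Ex n i p)
| Sigma_same_block m i p : is_Sigma n (S m) p -> is_Sigma n (S m) (Ex n i p).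

(** (V_a, ∈, U ∩ V_a) *)
Definition rank_structure (V : membership) (a U : V) : structure V :=
  Structure (rank_lt a) (@mem V) (fun x => x ∈ U /\ rank_lt a x).

(** Structures are nonempty, hence the condition a ≠ 0 (a universal first-order
    quantifier would hold vacuously in V_0). *)
Definition indescribable (V : membership) (n m : nat) (k : V) : Prop :=
  forall U : V, (forall x, x ∈ U -> rank_lt k x) ->
  forall p : form, is_Pi n m p -> sentence p ->
  models (rank_structure k U) p ->
  exists a, a ∈ k /\ ~ empty a /\ models (rank_structure a U) p.

(** ** The constructible universe *)

(** X ∈ Def(A): X is a subset of A definable over (A, ∈) with parameters from A.
    Only the free variables of p are assigned elements of A, so that closed
    formulas can be used when A is empty. *)
Definition definable_subset (V : membership) (A : V -> Prop) (X : V) : Prop :=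
  (forall x, x ∈ X -> A x) /\
  exists (p : form) (r : nat -> nat -> V),
    first_order p /\
    (forall i, free 0 i p -> i <> 0 -> A (r 0 i)) /\
    forall x, A x ->
      (x ∈ X <->
       sat (Structure A (@mem V) (fun _ => False)) (update r 0 0 x) p).

(** [L a x] : x ∈ L_a *)
Record L_hierarchy (V : membership) (L : V -> V -> Prop) : Prop := {
  L_zero : forall a x, empty a -> ~ L a x;
  L_succ : forall a b x, ordinal a -> succ a b ->
    (L b x <-> definable_subset (L a) x);
  L_limit : forall l x, limit_ordinal l ->
    (L l x <-> exists a, a ∈ l /\ L a x)
}.

Definition constructible (V : membership) (x : V) : Prop :=
  exists (L : V -> V -> Prop) (a : V), L_hierarchy L /\ ordinal a /\ L a x.

Definition V_eq_L (V : membership) : Prop := forall x : V, constructible x.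

(** ** End elementary extensions and unfoldable cardinals *)

Definition elementary_extension (V : membership) (A B : structure V) : Prop :=
  (forall x, dom A x -> dom B x) /\
  forall (p : form) (r : nat -> nat -> V),
    first_order p -> (forall i, dom A (r 0 i)) -> (sat A r p <-> sat B r p).

Definition end_elementary_extension (V : membership) (A B : structure V)
  : Prop :=
  elementary_extension A B /\
  (exists b, dom B b /\ ~ dom A b) /\
  forall a b, dom A a -> (dom A b /\ rel A b a <-> dom B b /\ rel B b a).

Definition well_founded_structure (V : membership) (M : structure V) : Prop :=
  well_founded (fun x y => dom M x /\ dom M y /\ rel M x y).

Definition transitive_in (V : membership) (M : structure V) (x : V) : Prop :=
  forall y z, dom M y -> dom M z -> rel M y x -> rel M z y -> rel M z x.

(** M ⊨ "x is an ordinal" *)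
Definition ordinal_in (V : membership) (M : structure V) (x : V) : Prop :=
  dom M x /\ transitive_in M x /\
  forall y, dom M y -> rel M y x -> transitive_in M y.

(** o(M) = h : h is the order type of the ordinals of M.  No transitivity of M
    is assumed. *)
Definition height (V : membership) (M : structure V) (h : V) : Prop :=
  ordinal h /\
  exists f : V -> V,
    (forall a, a ∈ h -> ordinal_in M (f a)) /\
    (forall a b, a ∈ h -> b ∈ h -> f a = f b -> a = b) /\
    (forall x, ordinal_in M x -> exists a, a ∈ h /\ f a = x) /\
    (forall a b, a ∈ h -> b ∈ h -> (a ∈ b <-> rel M (f a) (f b))).

Definition set_sized (V : membership) (M : structure V) : Prop :=
  exists d : V, forall x, x ∈ d <-> dom M x.

(** For ordinals, a ≤ h is a ⊆ h. *)
Definition unfoldable (V : membership) (k : V) : Prop :=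
  inaccessible k /\
  forall a S : V, ordinal a -> (forall x, x ∈ S -> rank_lt k x) ->
  exists M : structure V,
    set_sized M /\ well_founded_structure M /\
    end_elementary_extension (rank_structure k S) M /\
    exists h, height M h /\ a ⊆ h.

(* Main.v *)
Require Import Defs.
From Stdlib Require Import Arith Lia Cantor ClassicalEpsilon.
From Stdlib Require Import FunctionalExtensionality PropExtensionality.

(** Let U be a subset of V_k and p a sentence of order n + 1 that is true in
    (V_k, ∈, U).  If N is a transitive end elementary extension of V_k (with U
    as a predicate) that contains k and all objects of types 0, ..., n over
    V_k, then N sees that p is true in (V_k, ∈, U).  Hence N satisfies the
    first-order assertion that p is true in (V_a, ∈, U) for some ordinal
    a > 0, so V_k satisfies it too, and the ordinals of V_k are those below k.
    This is [reflect_sentence].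

    V = L provides N.  All objects of types 0, ..., n over V_k lie in some L_a,
    and unfoldability gives a well-founded end elementary extension of height
    more than a.  Its Mostowski collapse fixes V_k pointwise and contains all
    ordinals below the height ([transitive_end_extension]), so it remains to
    see that it contains L_a ([decode_level]).

    There is no need to formalize the syntax of set theory inside a model for
    this, because the predicate added to V_k may be any subset of V_k.  It
    codes, besides U, the relations x ∈ V_b, x ∈ L_b, and, for every formula q,
    the relation that x is definable over L_b by q with parameters; q is named
    by a natural number, and the set of these names is an element of V_k.  The
    relations obey recursion clauses that are single first-order sentences,
    one for each q in the case of definability and of comprehension.  An
    extension satisfies the same clauses, and since it has no new elements in
    the set of names, it has no new formulas.  By ∈-induction it then computes
    V_b and L_b correctly, and comprehension puts the elements of L_b into
    it.

    First-order definability is used semantically: [definable] predicates are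
    closed under connectives, quantifiers and satisfaction
    ([definable_sat_within]), and elementary extensions preserve them
    ([definable_elementary]). *)

Set Implicit Arguments.
Unset Strict Implicit.

Section UniverseOfSets.

Context (V : membership) (HV : ZFC V).

(** * Elementary set theory *)

Lemma set_ext (x y : V) : (forall z, z ∈ x <-> z ∈ y) -> x = y.
Proof. apply (ax_extensionality HV). Qed.

Lemma class_ext {T : Type} (P Q : T -> Prop) : (forall x, P x <-> Q x) -> P = Q.
Proof.
  intros H. apply functional_extensionality. intros x.
  now apply propositional_extensionality.
Qed.

Lemma separation (a : V) (P : V -> Prop) :
  exists b : V, forall x, x ∈ b <-> x ∈ a /\ P x.
Proof.
  destruct (ax_replacement HV (R := fun x y => y = x /\ P x) (a := a)) as [b Hb].
  - intros x y y' _ [-> _] [-> _]. reflexivity.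
  - exists b. intros y. rewrite Hb. split.
    + intros (x & Hx & -> & HP). auto.
    + intros [Hy HP]. exists y. auto.
Qed.

Lemma image_exists (a : V) (f : V -> V) :
  exists b : V, forall y, y ∈ b <-> exists x, x ∈ a /\ y = f x.
Proof.
  apply (ax_replacement HV (R := fun x y => y = f x) (a := a)).
  intros x y y' _ -> ->. reflexivity.
Qed.

Lemma empty_exists : exists e : V, empty e.
Proof. destruct (ax_infinity HV) as (w & (e & _ & He) & _). eauto. Qed.

Lemma empty_unique (x y : V) : empty x -> empty y -> x = y.
Proof. intros Hx Hy. apply set_ext. intros z. split; intros Hz; firstorder. Qed.

Lemma binary_union (x y : V) : exists u : V, forall z, z ∈ u <-> z ∈ x \/ z ∈ y.
Proof.
  destruct (ax_pairing HV x y) as [p Hp]. destruct (ax_union HV p) as [u Hu].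
  exists u. intros z. rewrite Hu. split.
  - intros (w & Hw & Hz). apply Hp in Hw as [-> | ->]; auto.
  - intros [Hz | Hz]; [exists x | exists y]; rewrite Hp; auto.
Qed.

Lemma succ_exists (x : V) : exists y, succ x y.
Proof.
  destruct (ax_pairing HV x x) as [s Hs]. destruct (binary_union x s) as [u Hu].
  exists u. intros z. rewrite Hu, Hs. tauto.
Qed.

Definition inhabitant : inhabited V :=
  match empty_exists with ex_intro _ e _ => inhabits e end.

(** A chosen element of the class P, arbitrary if P is empty. *)
Definition the (P : V -> Prop) : V := epsilon inhabitant P.

Lemma the_spec (P : V -> Prop) : (exists x, P x) -> P (the P).
Proof. apply epsilon_spec. Qed.

Fixpoint num (n : nat) : V :=
  match n with
  | 0 => the (@empty V)
  | S n => the (succ (num n))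
  end.

Arguments num : simpl never.

Lemma num_zero : empty (num 0).
Proof. exact (the_spec empty_exists). Qed.

Lemma num_succ (n : nat) : succ (num n) (num (S n)).
Proof. exact (the_spec (succ_exists (num n))). Qed.

Lemma succ_unique (x y y' : V) : succ x y -> succ x y' -> y = y'.
Proof. intros H H'. apply set_ext. intros z. rewrite (H z), (H' z). tauto. Qed.

Lemma omega_exists : exists w : V, forall x, x ∈ w <-> exists n, x = num n.
Proof.
  destruct (ax_infinity HV) as (w & (e & He & Hee) & Hw).
  destruct (separation w (fun x => exists n, x = num n)) as [o Ho].
  exists o. intros x. rewrite Ho. split; [tauto |]. intros [n ->].
  split; [| eauto]. induction n as [| n IH].
  - rewrite (empty_unique num_zero Hee). exact He.
  - destruct (Hw _ IH) as (y & Hy & Hs).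
    now rewrite (succ_unique (num_succ n) Hs).
Qed.

Lemma mem_irrefl (x : V) : x ∉ x.
Proof.
  intros Hx. destruct (ax_pairing HV x x) as [p Hp].
  destruct (ax_foundation HV (x := p)) as (y & Hy & Hmin).
  - intros He. apply (He x), Hp. auto.
  - apply Hp in Hy. assert (y = x) as -> by tauto.
    apply (Hmin x Hx), Hp. auto.
Qed.

Lemma num_lt (m n : nat) : m < n -> num m ∈ num n.
Proof.
  induction 1 as [| n _ IH].
  - apply (num_succ m). auto.
  - apply (num_succ n). auto.
Qed.

Lemma num_inj (m n : nat) : num m = num n -> m = n.
Proof.
  intros H. destruct (Nat.lt_trichotomy m n) as [Hl | [Hl | Hl]]; trivial;
    apply num_lt in Hl; rewrite H in Hl; destruct (mem_irrefl Hl).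
Qed.

(** The axiom of foundation speaks of sets only; a class is reached through
    the transitive closure of one of its elements. *)
Lemma mem_well_founded : well_founded (@mem V).
Proof.
  destruct omega_exists as [w Hw].
  intros x. apply NNPP. intros Hx.
  pose (iter := fix iter (n : nat) : V := match n with
    | 0 => the (fun p => forall z, z ∈ p <-> z = x \/ z = x)
    | S n => the (fun u => forall z, z ∈ u <-> exists y, y ∈ iter n /\ z ∈ y)
    end).
  assert (H0 : x ∈ iter 0)
    by (apply (the_spec (ax_pairing HV x x)); auto).
  assert (HS : forall n z y, y ∈ iter n -> z ∈ y -> z ∈ iter (S n)).
  { intros n z y Hy Hz. apply (the_spec (ax_union HV (iter n))). eauto. }
  destruct (ax_replacement HV
    (R := fun i y => exists n, i = num n /\ y = iter n) (a := w)) as [s Hs].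
  { intros i y y' _ (n & -> & ->) (n' & Hn & ->). revert Hn.
    intros Hn. now rewrite (num_inj Hn). }
  destruct (ax_union HV s) as [t Ht].
  destruct (separation t (fun y => ~ Acc (@mem V) y)) as [b Hb].
  destruct (ax_foundation HV (x := b)) as (y & Hy & Hmin).
  - intros He. apply (He x), Hb. split; [| exact Hx].
    apply Ht. exists (iter 0). split; [| exact H0].
    apply Hs. exists (num 0). split; [apply Hw |]; eauto.
  - apply Hb in Hy as [Hyt HyA]. apply HyA. constructor. intros z Hz.
    apply NNPP. intros HzA. apply (Hmin z Hz), Hb. split; [| exact HzA].
    apply Ht in Hyt as (i & Hi & Hyi). apply Hs in Hi as (j & _ & n & -> & ->).
    apply Ht. exists (iter (S n)). split; [| eauto].
    apply Hs. exists (num (S n)). split; [apply Hw |]; eauto.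
Qed.

Lemma mem_ind (P : V -> Prop) :
  (forall x, (forall y, y ∈ x -> P y) -> P x) -> forall x, P x.
Proof. exact (well_founded_ind mem_well_founded P). Qed.

(** * Ordinals *)

Lemma ordinal_mem (x y : V) : ordinal y -> x ∈ y -> ordinal x.
Proof.
  intros [Ht He] Hx. split; [apply He, Hx |].
  intros z Hz. apply He, (Ht x Hx), Hz.
Qed.

(** If neither ordinal is an element of the other, the induction hypotheses
    make each a subset of the other. *)
Lemma ordinal_trichotomy (x : V) :
  forall y, ordinal x -> ordinal y -> x ∈ y \/ x = y \/ y ∈ x.
Proof.
  induction x as [x IHx] using mem_ind. intros y.
  induction y as [y IHy] using mem_ind. intros Ox Oy.
  destruct (classic (x ∈ y)) as [| Hxy]; auto.
  destruct (classic (y ∈ x)) as [| Hyx]; auto.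
  right; left. apply set_ext. intros z. split; intros Hz.
  - destruct (IHx z Hz y (ordinal_mem Ox Hz) Oy) as [| [-> | H]]; trivial.
    + contradiction.
    + destruct Hyx. exact (proj1 Ox z Hz y H).
  - destruct (IHy z Hz Ox (ordinal_mem Oy Hz)) as [H | [-> | H]]; trivial.
    + destruct Hxy. exact (proj1 Oy z Hz x H).
    + contradiction.
Qed.

Lemma ordinal_subset (x y : V) :
  ordinal x -> ordinal y -> x ⊆ y -> x = y \/ x ∈ y.
Proof.
  intros Ox Oy H. destruct (ordinal_trichotomy Ox Oy) as [| [|H']]; auto.
  destruct (mem_irrefl (H y H')).
Qed.

Lemma ordinal_succ (x y : V) : ordinal x -> succ x y -> ordinal y.
Proof.
  intros [Ht He] Hs. split.
  - intros z Hz w Hw. apply Hs. left. apply Hs in Hz as [Hz | ->]; trivial.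
    exact (Ht z Hz w Hw).
  - intros z Hz. apply Hs in Hz as [Hz | ->]; auto.
Qed.

Lemma ordinal_union (a u : V) :
  (forall x, x ∈ a -> ordinal x) ->
  (forall z, z ∈ u <-> exists y, y ∈ a /\ z ∈ y) -> ordinal u.
Proof.
  intros Ha Hu. split.
  - intros y Hy z Hz. apply Hu in Hy as (x & Hx & Hy). apply Hu.
    exists x. split; trivial. exact (proj1 (Ha x Hx) y Hy z Hz).
  - intros y Hy. apply Hu in Hy as (x & Hx & Hy). exact (proj2 (Ha x Hx) y Hy).
Qed.

Lemma ordinal_cases (a : V) : ordinal a ->
  empty a \/ (exists x, ordinal x /\ succ x a) \/ limit_ordinal a.
Proof.
  intros Oa. destruct (classic (empty a)) as [| Hne]; auto. right.
  destruct (classic (limit_ordinal a)) as [| Hl]; auto. left.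
  apply NNPP. intros Hs. apply Hl. split; [exact Oa | split; [exact Hne |]].
  intros x Hx. apply NNPP. intros Hmax. apply Hs.
  exists x. split; [exact (ordinal_mem Oa Hx) |]. intros y. split.
  - intros Hy.
    destruct (ordinal_trichotomy (ordinal_mem Oa Hx) (ordinal_mem Oa Hy))
      as [H | [H | H]]; auto. destruct Hmax. eauto.
  - intros [Hy | ->]; trivial. exact (proj1 Oa x Hx y Hy).
Qed.

(** * Ranks *)

Lemma rank_lt_iff (a x : V) :
  rank_lt a x <-> exists b, b ∈ a /\ forall y, y ∈ x -> rank_lt b y.
Proof.
  split.
  - intros H. destruct H as [a x b Hb H]. eauto.
  - intros (b & Hb & H). econstructor; eauto.
Qed.

Lemma rank_lt_mono (a a' x : V) : a ⊆ a' -> rank_lt a x -> rank_lt a' x.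
Proof. rewrite !rank_lt_iff. intros Ha (b & Hb & H). eauto. Qed.

Lemma rank_lt_mem (a : V) : forall x, x ∈ a -> rank_lt a x.
Proof.
  induction a as [a IH] using mem_ind. intros x Hx.
  econstructor; [exact Hx |]. exact (IH x Hx).
Qed.

(** [rank_lt a x] compares the ranks of a and x for arbitrary sets a, not only
    ordinals, and is transitive as such.  This allows arbitrary indices b in
    V_b and L_b below. *)
Lemma rank_lt_trans (a x : V) :
  rank_lt a x -> forall y, rank_lt x y -> rank_lt a y.
Proof.
  induction 1 as [a x b Hb _ IH]. intros y Hy.
  apply rank_lt_iff in Hy as (z & Hz & Hy).
  econstructor; [exact Hb |]. eauto.
Qed.

Lemma rank_lt_transitive (a x y : V) : rank_lt a x -> y ∈ x -> rank_lt a y.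
Proof. intros Hx Hy. exact (rank_lt_trans Hx (rank_lt_mem Hy)). Qed.

Lemma rank_lt_irrefl (x : V) : ~ rank_lt x x.
Proof.
  induction x as [x IH] using mem_ind. intros Hx.
  apply rank_lt_iff in Hx as (y & Hy & H). exact (IH y Hy (H y Hy)).
Qed.

Lemma rank_lt_ordinal (a x : V) :
  ordinal a -> ordinal x -> rank_lt a x -> x ∈ a.
Proof.
  intros Oa Ox H. destruct (ordinal_trichotomy Oa Ox) as [Hm | [-> | Hm]]; trivial.
  - destruct (rank_lt_irrefl (rank_lt_trans H (rank_lt_mem Hm))).
  - destruct (rank_lt_irrefl H).
Qed.

Lemma rank_set_exists (a : V) : exists v : V, forall x, x ∈ v <-> rank_lt a x.
Proof.
  induction a as [a IH] using mem_ind.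
  pose (stage b := the (fun v => forall x, x ∈ v <-> rank_lt b x)).
  pose (pow x := the (fun p => forall z, z ∈ p <-> z ⊆ x)).
  destruct (image_exists a (fun b => pow (stage b))) as [s Hs].
  destruct (ax_union HV s) as [v Hv]. exists v. intros x.
  rewrite Hv, rank_lt_iff. split.
  - intros (y & Hy & Hx). apply Hs in Hy as (b & Hb & ->).
    exists b. split; trivial. intros z Hz.
    apply (the_spec (IH b Hb)). fold (stage b).
    apply (proj1 (the_spec (ax_powerset HV (stage b)) x) Hx), Hz.
  - intros (b & Hb & Hx). exists (pow (stage b)). split; [apply Hs; eauto |].
    apply (the_spec (ax_powerset HV (stage b)) x). intros z Hz.
    apply (the_spec (IH b Hb)). auto.
Qed.

Lemma objects_exist (D : V -> Prop) (d : V) :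
  (forall x, x ∈ d <-> D x) ->
  forall n, exists b : V, forall t x, t <= n -> object D t x -> x ∈ b.
Proof.
  intros Hd.
  assert (Hone : forall t, exists b : V, forall x, object D t x -> x ∈ b).
  { induction t as [| t [b Hb]].
    - exists d. intros x. apply Hd.
    - destruct (ax_powerset HV b) as [p Hp]. exists p. intros x Hx.
      apply Hp. intros y Hy. apply Hb, Hx, Hy. }
  induction n as [| n [b Hb]].
  - destruct (Hone 0) as [b Hb]. exists b. intros t x Ht.
    replace t with 0 by lia. apply Hb.
  - destruct (Hone (S n)) as [c Hc]. destruct (binary_union b c) as [u Hu].
    exists u. intros t x Ht Hx. apply Hu.
    destruct (Nat.eq_dec t (S n)) as [-> |]; auto.
    left. apply (Hb t); [lia | exact Hx].
Qed.

(** * Ordered pairs *)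

Definition is_upair (z u v : V) : Prop := 
  u ∈ z /\ v ∈ z /\ forall w, w ∈ z -> w = u \/ w = v.

(** Kuratowski's pair, in a form that only quantifies over elements of
    elements of [p], so that it means the same in every transitive class. *)
Definition is_pair (p u v : V) : Prop :=
  (exists z, z ∈ p /\ is_upair z u u) /\
  (exists z, z ∈ p /\ is_upair z u v) /\
  forall z, z ∈ p -> is_upair z u u \/ is_upair z u v.

Lemma upair_exists (u v : V) : exists z, is_upair z u v.
Proof.
  destruct (ax_pairing HV u v) as [p Hp]. exists p. split; [| split].
  - apply Hp. auto.
  - apply Hp. auto.
  - intros w. apply Hp.
Qed.

Lemma upair_in (z u v : V) : is_upair z u v -> forall w, w ∈ z <-> w = u \/ w = v.
Proof. intros (Hu & Hv & H) w. split; [apply H |]. intros [-> | ->]; trivial. Qed.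

Lemma pair_exists (u v : V) : exists p, is_pair p u v.
Proof.
  destruct (upair_exists u u) as [a Ha], (upair_exists u v) as [b Hb].
  destruct (ax_pairing HV a b) as [p Hp]. exists p. split; [| split].
  - exists a. rewrite Hp. auto.
  - exists b. rewrite Hp. auto.
  - intros z Hz. apply Hp in Hz as [-> | ->]; auto.
Qed.

Lemma pair_inj (p u v u' v' : V) :
  is_pair p u v -> is_pair p u' v' -> u = u' /\ v = v'.
Proof.
  intros ((a & Ha & Hau) & (b & Hb & Hbu) & H) ((a' & Ha' & Hau') & (b' & Hb' & Hbu') & H').
  assert (u' = u) as ->.
  { destruct (H' a Ha) as [K | K]; destruct K as (K & _ & _);
      apply (upair_in Hau) in K; tauto. }
  split; trivial.
  assert (E : v = u \/ v = v').
  { destruct (H' b Hb) as [K | K]; destruct Hbu as (_ & Hv & _);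
      apply (upair_in K) in Hv; tauto. }
  assert (E' : v' = u \/ v' = v).
  { destruct (H b' Hb') as [K | K]; destruct Hbu' as (_ & Hv & _);
      apply (upair_in K) in Hv; tauto. }
  destruct E, E'; congruence.
Qed.

Definition is_triple (s c b x : V) : Prop :=
  exists t, is_pair t b x /\ is_pair s c t.

Lemma triple_inj (s c b x c' b' x' : V) :
  is_triple s c b x -> is_triple s c' b' x' -> c = c' /\ b = b' /\ x = x'.
Proof.
  intros (t & Ht & Hs) (t' & Ht' & Hs').
  destruct (pair_inj Hs Hs') as [-> <-]. destruct (pair_inj Ht Ht'). auto.
Qed.

Lemma pair_mem (D : V -> Prop) (p u v : V) :
  (forall x y, D x -> y ∈ x -> D y) -> is_pair p u v -> D p -> D u /\ D v.
Proof.
  intros HD (_ & (z & Hz & Hu & Hv & _) & _) Hp. split; eauto.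
Qed.

(** * Formulas *)

Lemma update_same (r : nat -> nat -> V) t i x : update r t i x t i = x.
Proof. unfold update. now rewrite !Nat.eqb_refl. Qed.

Lemma update_other (r : nat -> nat -> V) t i x s j :
  ~ (s = t /\ j = i) -> update r t i x s j = r s j.
Proof.
  intros H. unfold update.
  destruct (Nat.eqb_spec s t), (Nat.eqb_spec j i); simpl; tauto.
Qed.

Lemma sat_agree (A : structure V) p : forall r r',
  (forall t i, free t i p -> r t i = r' t i) -> sat A r p <-> sat A r' p.
Proof.
  induction p as [| i j | i | t i j | t i j | q IHq q' IHq' | t i q IH | t i q IH];
    intros r r' H; simpl in *.
  - tauto.
  - rewrite !(H 0) by auto. tauto.
  - rewrite !(H 0) by auto. tauto.
  - rewrite !(H t) by auto. tauto.
  - rewrite (H t), (H (S t)) by auto. tauto.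
  - rewrite (IHq r r'), (IHq' r r') by auto. tauto.
  - assert (E : forall x, sat A (update r t i x) q <-> sat A (update r' t i x) q).
    { intros x. apply IH. intros s j Hf.
      destruct (classic (s = t /\ j = i)) as [[-> ->] | Hn].
      - now rewrite !update_same.
      - rewrite !update_other by trivial. apply H. auto. }
    split; intros K x Hx; apply E, K, Hx.
  - assert (E : forall x, sat A (update r t i x) q <-> sat A (update r' t i x) q).
    { intros x. apply IH. intros s j Hf.
      destruct (classic (s = t /\ j = i)) as [[-> ->] | Hn].
      - now rewrite !update_same.
      - rewrite !update_other by trivial. apply H. auto. }
    split; intros (x & Hx & K); exists x; split; trivial; apply E, K.
Qed.

Lemma free_order n p : has_order n p -> forall t i, free t i p -> t < n.
Proof.
  induction p; simpl; intros Ho t' i' Hf; try tauto.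
  - destruct Hf as [-> _]. exact Ho.
  - destruct Hf as [-> _]. exact Ho.
  - destruct Hf as [-> _]. exact Ho.
  - destruct Hf as [[-> _] | [-> _]]; lia.
  - destruct Ho, Hf; eauto.
  - destruct Ho, Hf; eauto.
  - destruct Ho, Hf; eauto.
Qed.

Lemma free_bounded p : exists K, forall t i, free t i p -> i < K.
Proof.
  induction p as [| i j | i | t i j | t i j | q [K IHq] q' [K' IHq'] | t i q [K IH] | t i q [K IH]];
    simpl.
  - exists 0. tauto.
  - exists (S (i + j)). lia.
  - exists (S i). lia.
  - exists (S (i + j)). lia.
  - exists (S (i + j)). lia.
  - exists (K + K'). intros s k [Hf | Hf]; [apply IHq in Hf | apply IHq' in Hf]; lia.
  - exists K. intros s k [Hf _]. eauto.
  - exists K. intros s k [Hf _]. eauto.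
Qed.

Scheme is_Pi_mut := Induction for is_Pi Sort Prop
  with is_Sigma_mut := Induction for is_Sigma Sort Prop.

Lemma is_Pi_order n m p : is_Pi n m p -> has_order (S n) p.
Proof.
  apply (is_Pi_mut (n := n) (P := fun m p _ => has_order (S n) p)
    (P0 := fun m p _ => has_order (S n) p)); simpl; auto.
Qed.

Fixpoint form_code (p : form) : nat :=
  match p with
  | Bot => to_nat (0, 0)
  | Rel i j => to_nat (1, to_nat (i, j))
  | Pred i => to_nat (2, i)
  | Eq t i j => to_nat (3, to_nat (t, to_nat (i, j)))
  | In t i j => to_nat (4, to_nat (t, to_nat (i, j)))
  | Imp q q' => to_nat (5, to_nat (form_code q, form_code q'))
  | All t i q => to_nat (6, to_nat (t, to_nat (i, form_code q)))
  | Ex t i q => to_nat (7, to_nat (t, to_nat (i, form_code q)))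
  end.

Lemma form_code_inj p : forall p', form_code p = form_code p' -> p = p'.
Proof.
  assert (inj : forall a b c d, to_nat (a, b) = to_nat (c, d) -> a = c /\ b = d).
  { intros a b c d H. apply to_nat_inj in H. inversion H. auto. }
  induction p; intros []; cbn [form_code]; intros H; apply inj in H as [Hc H];
    try discriminate Hc; repeat (apply inj in H as [? H]); subst; f_equal; auto.
Qed.

(** * The constructible hierarchy *)

(** Variable 0 stands for the element z of the defined set, the other free
    variables for parameters. *)
Definition defined_by (A : V -> Prop) (q : form) (r : nat -> V) (X : V) : Prop :=
  forall z, z ∈ X <-> A z /\
    sat (Structure A (@mem V) (fun _ => False)) (update (fun _ => r) 0 0 z) q.

Definition parameters_in (A : V -> Prop) (q : form) (r : nat -> V) : Prop :=
  forall i, free 0 i q -> i <> 0 -> A (r i).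

Lemma sat_first_order (A : structure V) q r r' :
  first_order q -> (forall i, free 0 i q -> r 0 i = r' 0 i) ->
  sat A r q <-> sat A r' q.
Proof.
  intros Hq H. apply sat_agree. intros t i Hf.
  assert (t = 0) as -> by (apply (free_order Hq) in Hf; lia). auto.
Qed.

Lemma definable_subset_iff (A : V -> Prop) (X : V) :
  definable_subset A X <-> exists q r,
    first_order q /\ parameters_in A q r /\ defined_by A q r X.
Proof.
  split.
  - intros (HX & q & r & Hq & Hr & H). exists q, (r 0). repeat split; trivial.
    + auto.
    + rewrite (@sat_first_order _ q _ (update r 0 0 z) Hq) by reflexivity.
      apply H; auto.
    + rewrite (@sat_first_order _ q _ (update r 0 0 z) Hq) by reflexivity.
      intros [Hz Hs]. apply H; auto.
  - intros (q & r & Hq & Hr & H). split; [apply H |].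
    exists q, (fun _ => r). repeat split; trivial; [apply H | intros; apply H; auto].
Qed.

(** L_b as the union of the Def(L_c), c ∈ b, for every set b.  In this form the
    recursion needs no distinction of successors and limits, and two models can
    be compared by ∈-induction on arbitrary sets. *)
Definition Lset : V -> V -> Prop :=
  Fix mem_well_founded (fun _ => V -> Prop)
    (fun b L x => exists c (H : c ∈ b), definable_subset (L c H) x).

Lemma Lset_iff (b x : V) :
  Lset b x <-> exists c, c ∈ b /\ definable_subset (Lset c) x.
Proof.
  unfold Lset at 1. rewrite Fix_eq.
  - fold Lset. split.
    + intros (c & Hc & Hx). exists c. auto.
    + intros (c & Hc & Hx). exists c, Hc. exact Hx.
  - intros c L L' H. replace L' with L; trivial.
    apply functional_extensionality_dep. intros y.
    apply functional_extensionality_dep. intros Hy. apply H.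
Qed.

Lemma Lset_mono (a b x : V) : a ⊆ b -> Lset a x -> Lset b x.
Proof. rewrite !Lset_iff. intros H (c & Hc & Hx). eauto. Qed.

Lemma Lset_subset (b x : V) : Lset b x -> exists c, c ∈ b /\ forall y, y ∈ x -> Lset c y.
Proof. rewrite Lset_iff. intros (c & Hc & H & _). eauto. Qed.

Lemma Lset_rank (b : V) : forall x, Lset b x -> rank_lt b x.
Proof.
  induction b as [b IH] using mem_ind. intros x Hx.
  apply Lset_subset in Hx as (c & Hc & Hx).
  econstructor; [exact Hc |]. auto.
Qed.

(** Every X ∈ L_a is the subset of L_a that the formula z ∈ X defines. *)
Lemma Lset_definable (a x : V) :
  transitive a -> Lset a x -> definable_subset (Lset a) x.
Proof.
  intros Ta Hx. apply definable_subset_iff.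
  exists (Rel 0 1), (fun _ => x). split; [| split].
  - exact (le_n 1).
  - intros _ _ _. exact Hx.
  - intros z. cbn. split; [| tauto]. intros Hz. split; trivial.
    apply Lset_subset in Hx as (c & Hc & Hx). apply (Lset_mono (a := c)); auto.
Qed.

(** At a successor b + 1, the union of the Def(L_c), c ≤ b, is Def(L_b) because
    L_c ⊆ L_b ⊆ Def(L_b). *)
Lemma L_hierarchy_Lset (L : V -> V -> Prop) : L_hierarchy L ->
  forall a, ordinal a -> L a = Lset a.
Proof.
  intros HL a. induction a as [a IH] using mem_ind. intros Oa.
  apply class_ext. intros x.
  destruct (ordinal_cases Oa) as [He | [(b & Ob & Hs) | Hl]].
  - split; intros Hx; [destruct (L_zero HL He Hx) |].
    apply Lset_iff in Hx as (c & Hc & _). destruct (He c Hc).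
  - rewrite (L_succ HL x Ob Hs), Lset_iff.
    rewrite (IH b) by (trivial; apply Hs; auto). split.
    + intros Hx. exists b. split; trivial. apply Hs. auto.
    + intros (c & Hc & Hx). apply Hs in Hc as [Hc | ->]; trivial.
      apply Lset_definable; [exact (proj1 Ob) |]. apply Lset_iff. eauto.
  - rewrite (L_limit HL x Hl). split.
    + intros (b & Hb & Hx). rewrite (IH b Hb (ordinal_mem Oa Hb)) in Hx.
      exact (Lset_mono (proj1 Oa b Hb) Hx).
    + intros Hx. apply Lset_iff in Hx as (c & Hc & Hx).
      destruct Hl as (_ & _ & Hl). destruct (Hl c Hc) as (b & Hb & Hcb).
      exists b. split; trivial. rewrite (IH b Hb (ordinal_mem Oa Hb)).
      apply Lset_iff. eauto.
Qed.

(** Replacement, for a choice of a level containing each element. *)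
Lemma constructible_bound (HL : V_eq_L V) (B : V) :
  exists a, ordinal a /\ forall x, x ∈ B -> Lset a x.
Proof.
  pose (level x := the (fun a => ordinal a /\ Lset a x)).
  assert (Hlevel : forall x, ordinal (level x) /\ Lset (level x) x).
  { intros x. apply (the_spec (P := fun a => ordinal a /\ Lset a x)).
    destruct (HL x) as (L & a & HLh & Oa & Hx). exists a. split; trivial.
    rewrite <- (L_hierarchy_Lset HLh Oa). exact Hx. }
  destruct (image_exists B level) as [s Hs]. destruct (ax_union HV s) as [u Hu].
  exists u. split.
  - apply (ordinal_union (a := s)); trivial. intros y Hy.
    apply Hs in Hy as (x & _ & ->). apply Hlevel.
  - intros x Hx. apply (Lset_mono (a := level x)); [| apply Hlevel].
    intros z Hz. apply Hu. exists (level x). split; trivial. apply Hs. eauto.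
Qed.

(** * First-order definable predicates on transitive classes *)

Definition transitive_class (D : V -> Prop) : Prop :=
  forall x y, D x -> y ∈ x -> D y.

(** A predicate of structures (D, ∈, P) and assignments e of variables. *)
Definition predicate : Type := (V -> Prop) -> (V -> Prop) -> (nat -> V) -> Prop.

(** De Bruijn convention: e 0 is the variable bound last.  Formulas have named
    variables, so Φ is required to be expressible for every allocation s of
    names to its variables that leaves all names ≥ K unused; binding a variable
    then takes the fresh name K ([definable_all]). *)
Definition definable (Φ : predicate) : Prop :=
  forall s, (exists K, forall i : nat, s i < K) ->
  exists p, first_order p /\ forall D P r,
    transitive_class D -> (forall i, D (r 0 i)) ->
    (sat (Structure D (@mem V) P) r p <-> Φ D P (fun i => r 0 (s i))).

Lemma definable_ext (Φ Ψ : predicate) :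
  (forall D P e, transitive_class D -> (forall i, D (e i)) ->
    (Φ D P e <-> Ψ D P e)) ->
  definable Φ -> definable Ψ.
Proof.
  intros H HΦ s Hs. destruct (HΦ s Hs) as (p & Hp & Hsat).
  exists p. split; trivial. intros D P r HD Hr.
  rewrite (Hsat D P r HD Hr). apply H; auto.
Qed.

Lemma definable_rename (Φ : predicate) (f : nat -> nat) :
  definable Φ -> definable (fun D P e => Φ D P (fun i => e (f i))).
Proof.
  intros H s [K Hs].
  destruct (H (fun i => s (f i))) as (p & Hp & Hsat); [eauto |].
  exists p. split; trivial.
Qed.

Lemma definable_mem (i j : nat) : definable (fun D P e => e i ∈ e j).
Proof. intros s _. exists (Rel (s i) (s j)). split; [exact (le_n 1) | reflexivity]. Qed.

Lemma definable_eq (i j : nat) : definable (fun D P e => e i = e j).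
Proof. intros s _. exists (Eq 0 (s i) (s j)). split; [exact (le_n 1) | reflexivity]. Qed.

Lemma definable_pred (i : nat) : definable (fun D P e => P (e i)).
Proof. intros s _. exists (Pred (s i)). split; [exact (le_n 1) | reflexivity]. Qed.

Lemma definable_imp (Φ Ψ : predicate) : definable Φ -> definable Ψ ->
  definable (fun D P e => Φ D P e -> Ψ D P e).
Proof.
  intros H H' s Hs.
  destruct (H s Hs) as (p & Hp & Hsat), (H' s Hs) as (p' & Hp' & Hsat').
  exists (Imp p p'). split; [split; trivial |]. intros D P r HD Hr. simpl.
  rewrite (Hsat D P r HD Hr), (Hsat' D P r HD Hr). reflexivity.
Qed.

Lemma definable_const (C : Prop) : definable (fun D P e => C).
Proof.
  intros s _. destruct (classic C) as [HC | HC].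
  - exists (Imp Bot Bot). simpl. split; [split; exact I | tauto].
  - exists Bot. simpl. split; [exact I | tauto].
Qed.

Lemma definable_not (Φ : predicate) :
  definable Φ -> definable (fun D P e => ~ Φ D P e).
Proof. intros H. exact (definable_imp H (definable_const False)). Qed.

Lemma definable_and (Φ Ψ : predicate) : definable Φ -> definable Ψ ->
  definable (fun D P e => Φ D P e /\ Ψ D P e).
Proof.
  intros H H'. eapply definable_ext;
    [| exact (definable_not (definable_imp H (definable_not H')))].
  intros D P e _ _. simpl. tauto.
Qed.

Lemma definable_or (Φ Ψ : predicate) : definable Φ -> definable Ψ ->
  definable (fun D P e => Φ D P e \/ Ψ D P e).
Proof.
  intros H H'. eapply definable_ext;
    [| exact (definable_imp (definable_not H) H')].
  intros D P e _ _. simpl. tauto.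
Qed.

Lemma definable_iff (Φ Ψ : predicate) : definable Φ -> definable Ψ ->
  definable (fun D P e => Φ D P e <-> Ψ D P e).
Proof. intros H H'. apply definable_and; apply definable_imp; assumption. Qed.

Lemma definable_all
  (B : (V -> Prop) -> (V -> Prop) -> (nat -> V) -> V -> Prop) :
  definable (fun D P e => B D P (fun i => e (S i)) (e 0)) ->
  definable (fun D P e => forall x, D x -> B D P e x).
Proof.
  intros H s [K Hs].
  destruct (H (fun i => match i with 0 => K | S i => s i end))
    as (p & Hp & Hsat).
  { exists (S K). intros [| i]; [lia | specialize (Hs i); lia]. }
  exists (All 0 K p). split; [exact (conj (le_n 1) Hp) |].
  intros D P r HD Hr. simpl.
  assert (E : forall x, D x ->
    (sat (Structure D (@mem V) P) (update r 0 K x) p <->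
     B D P (fun i => r 0 (s i)) x)).
  { intros x Hx. rewrite Hsat; trivial.
    - rewrite update_same.
      replace (fun i => update r 0 K x 0 (s i)) with (fun i => r 0 (s i));
        [reflexivity |].
      apply functional_extensionality. intros i. rewrite update_other; trivial.
      specialize (Hs i). lia.
    - intros i. unfold update. destruct (_ && _)%bool; auto. }
  split; intros Hall x Hx; apply E; auto.
Qed.

Lemma definable_ex
  (B : (V -> Prop) -> (V -> Prop) -> (nat -> V) -> V -> Prop) :
  definable (fun D P e => B D P (fun i => e (S i)) (e 0)) ->
  definable (fun D P e => exists x, D x /\ B D P e x).
Proof.
  intros H. eapply definable_ext;
    [| exact (definable_not (definable_all
        (B := fun D P e x => ~ B D P e x) (definable_not H)))].
  intros D P e _ _. simpl. split.
  - intros Hn. apply NNPP. intros Hc. apply Hn. eauto.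
  - intros (x & Hx & HB) Hn. exact (Hn x Hx HB).
Qed.

(** Bounded quantifiers need no relativization, since D is transitive. *)
Lemma definable_ball (j : nat)
  (B : (V -> Prop) -> (V -> Prop) -> (nat -> V) -> V -> Prop) :
  definable (fun D P e => B D P (fun i => e (S i)) (e 0)) ->
  definable (fun D P e => forall x, x ∈ e j -> B D P e x).
Proof.
  intros H. eapply definable_ext;
    [| exact (definable_all (B := fun D P e x => x ∈ e j -> B D P e x)
        (definable_imp (definable_mem 0 (S j)) H))].
  intros D P e HD He. simpl. split; eauto.
Qed.

Lemma definable_bex (j : nat)
  (B : (V -> Prop) -> (V -> Prop) -> (nat -> V) -> V -> Prop) :
  definable (fun D P e => B D P (fun i => e (S i)) (e 0)) ->
  definable (fun D P e => exists x, x ∈ e j /\ B D P e x).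
Proof.
  intros H. eapply definable_ext;
    [| exact (definable_ex (B := fun D P e x => x ∈ e j /\ B D P e x)
        (definable_and (definable_mem 0 (S j)) H))].
  intros D P e HD He. simpl. split.
  - intros (x & _ & Hx). eauto.
  - intros (x & Hx & HB). eauto.
Qed.

Ltac definability := cbn beta iota; repeat first
  [ assumption
  | apply definable_mem | apply definable_eq | apply definable_pred
  | apply definable_const
  | apply definable_iff | apply definable_and | apply definable_or
  | apply definable_not
  | apply definable_ball; cbn beta iota | apply definable_bex; cbn beta iota
  | apply definable_all; cbn beta iota | apply definable_ex; cbn beta iota
  | apply definable_imp ].

Lemma definable_ordinal (i : nat) : definable (fun D P e => ordinal (e i)).
Proof. unfold ordinal, transitive, subset. definability. Qed.

Lemma definable_forall_nat (Φ : nat -> predicate) (K : nat) :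
  (forall i, definable (Φ i)) ->
  definable (fun D P e => forall i, i < K -> Φ i D P e).
Proof.
  intros H. induction K as [| K IH].
  - eapply definable_ext; [| exact (definable_const True)].
    intros D P e _ _. split; trivial. intros _ i Hi. lia.
  - eapply definable_ext; [| exact (definable_and IH (H K))].
    intros D P e _ _. split.
    + intros [Hall HK] i Hi. destruct (Nat.eq_dec i K) as [-> |]; trivial.
      apply Hall. lia.
    + intros Hall. split; [intros i Hi |]; apply Hall; lia.
Qed.

Definition scons (x : V) (e : nat -> V) (i : nat) : V :=
  match i with 0 => x | S i => e i end.

(** A block of K quantifiers, written as one quantifier over assignments u of
    which only the first K values matter. *)
Lemma definable_ex_block (K : nat) :
  forall B : (V -> Prop) -> (V -> Prop) -> (nat -> V) -> (nat -> V) -> Prop,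
  (forall D P e u v, (forall i, i < K -> u i = v i) -> B D P e u -> B D P e v) ->
  definable (fun D P e => B D P (fun i => e (K + i)) e) ->
  definable (fun D P e => exists u, (forall i, D (u i)) /\ B D P e u).
Proof.
  induction K as [| K IH]; intros B HB H.
  - eapply definable_ext; [| exact H]. intros D P e _ He. simpl. split.
    + intros Hb. exists e. auto.
    + intros (u & _ & Hb). apply (HB D P e u); trivial. intros i Hi. lia.
  - eapply definable_ext with (Φ := fun D P e => exists x, D x /\
      (fun D P e x => exists u, (forall i, D (u i)) /\
        B D P e (scons x u)) D P e x).
    + intros D P e _ _. cbn beta. split.
      * intros (x & Hx & u & Hu & Hb). exists (scons x u). split; trivial.
        intros [| i]; simpl; auto.
      * intros (u & Hu & Hb). exists (u 0). split; trivial.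
        exists (fun i => u (S i)). split; trivial.
        apply (HB D P e u); trivial. intros [| i] _; reflexivity.
    + apply definable_ex. cbn beta.
      apply IH with (B := fun D P e u => B D P (fun i => e (S i)) (scons (e 0) u)).
      * intros D P e u v Huv. apply HB. intros [| i] Hi; simpl; trivial.
        apply Huv. lia.
      * (* The K inner variables come first and the outer variable, which is
           the head of the block, has index K: f moves it to the front. *)
        pose (f j := if j =? 0 then K else if j <=? K then Nat.pred j else j).
        eapply definable_ext; [| apply (definable_rename f H)].
        -- intros D P e _ _. cbn beta.
           replace (fun i => e (f (S K + i))) with (fun i => e (K + S i)).
           ++ assert (E : forall i, i < S K -> e (f i) = scons (e (K + 0)) e i).
              { intros [| i] Hi; unfold f; simpl.
                - now rewrite Nat.add_0_r.
                - destruct K; [lia |]. destruct (Nat.leb_spec i K); trivial. lia. }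
              split; apply HB; intros i Hi; [| symmetry]; auto.
           ++ apply functional_extensionality. intros i. f_equal. unfold f.
              destruct (Nat.leb_spec (S K + i) K); simpl; lia.
Qed.

Lemma definable_all_block (K : nat)
  (B : (V -> Prop) -> (V -> Prop) -> (nat -> V) -> (nat -> V) -> Prop) :
  (forall D P e u v, (forall i, i < K -> u i = v i) -> B D P e u -> B D P e v) ->
  definable (fun D P e => B D P (fun i => e (K + i)) e) ->
  definable (fun D P e => forall u, (forall i, D (u i)) -> B D P e u).
Proof.
  intros HB H. eapply definable_ext; [| apply definable_not;
    apply (@definable_ex_block K (fun D P e u => ~ B D P e u))].
  - intros D P e _ _. simpl. split.
    + intros Hn u Hu. apply NNPP. intros Hc. apply Hn. eauto.
    + intros Hall (u & Hu & Hn). auto.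
  - intros D P e u v Huv Hn Hb. apply Hn. apply (HB D P e v); trivial.
    intros i Hi. symmetry. auto.
  - apply definable_not, H.
Qed.

(** ** Satisfaction as a definable predicate *)

(** Satisfaction of a formula of finite order in (A, ∈, U), with all
    quantifiers restricted to D.  For definable A and U it is first-order over
    D, and it is true satisfaction when D contains all the objects that the
    formula speaks about ([sat_within_sat]). *)
Fixpoint sat_within (D A U : V -> Prop) (r : nat -> nat -> V) (p : form) : Prop :=
  match p with
  | Bot => False
  | Rel i j => r 0 i ∈ r 0 j
  | Pred i => U (r 0 i)
  | Eq t i j => r t i = r t j
  | In t i j => r t i ∈ r (S t) j
  | Imp q q' => sat_within D A U r q -> sat_within D A U r q'
  | All t i q => forall x, D x -> object A t x ->
      sat_within D A U (update r t i x) q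
  | Ex t i q => exists x, D x /\ (object A t x /\
      sat_within D A U (update r t i x) q)
  end.

Lemma sat_within_sat (D A U : V -> Prop) n q :
  (forall t x, t <= n -> object A t x -> D x) -> has_order (S n) q ->
  forall r, sat_within D A U r q <-> sat (Structure A (@mem V) U) r q.
Proof.
  intros HD. induction q as [| | | | | q IHq q' IHq' | t i q IH | t i q IH];
    intros Hq r; simpl in *; try reflexivity.
  - rewrite IHq, IHq' by tauto. reflexivity.
  - split; intros H x.
    + intros Hx. apply IH; [tauto |]. apply H; trivial. apply (HD t); trivial; lia.
    + intros _ Hx. apply IH; [tauto |]. auto.
  - split.
    + intros (x & _ & Hx & Hs). exists x. split; trivial. apply IH; tauto.
    + intros (x & Hx & Hs). exists x. split; [apply (HD t); trivial; lia |].
      split; trivial. apply IH; tauto.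
Qed.

Lemma definable_object
  (A : (V -> Prop) -> (V -> Prop) -> (nat -> V) -> V -> Prop) (t : nat) :
  definable (fun D P e => A D P (fun i => e (S i)) (e 0)) ->
  forall (f : nat -> nat) (j : nat),
  definable (fun D P e => object (A D P (fun i => e (f i))) t (e j)).
Proof.
  intros HA. induction t as [| t IH]; intros f j; simpl.
  - exact (definable_rename (fun i => match i with 0 => j | S i => f i end) HA).
  - apply definable_ball with
      (B := fun D P e x => object (A D P (fun i => e (f i))) t x).
    cbn beta. apply (IH (fun i => S (f i))).
Qed.

Lemma update_shift (e : nat -> V) (f : nat -> nat -> nat) t i :
  update (fun s j => e (S (f s j))) t i (e 0) =
  fun s j => e (if ((s =? t) && (j =? i))%bool then 0 else S (f s j)).
Proof.
  apply functional_extensionality. intros s.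
  apply functional_extensionality. intros j.
  unfold update. destruct (_ && _)%bool; reflexivity.
Qed.

Lemma definable_sat_within
  (A U : (V -> Prop) -> (V -> Prop) -> (nat -> V) -> V -> Prop) (q : form) :
  definable (fun D P e => A D P (fun i => e (S i)) (e 0)) ->
  definable (fun D P e => U D P (fun i => e (S i)) (e 0)) ->
  forall (f : nat -> nat) (g : nat -> nat -> nat),
  definable (fun D P e =>
    sat_within D (A D P (fun i => e (f i))) (U D P (fun i => e (f i)))
      (fun t i => e (g t i)) q).
Proof.
  intros HA HU.
  induction q as [| i j | i | t i j | t i j | q IHq q' IHq' | t i q IH | t i q IH];
    intros f g; simpl.
  - apply definable_const.
  - apply definable_mem.
  - exact (definable_rename
      (fun k => match k with 0 => g 0 i | S k => f k end) HU).
  - apply definable_eq.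
  - apply definable_mem.
  - apply definable_imp; auto.
  - apply definable_all with (B := fun D P e x =>
      object (A D P (fun i => e (f i))) t x ->
      sat_within D (A D P (fun i => e (f i))) (U D P (fun i => e (f i)))
        (update (fun s j => e (g s j)) t i x) q).
    cbn beta. apply definable_imp.
    + exact (definable_object t HA (fun i => S (f i)) 0).
    + eapply definable_ext; [| exact (IH (fun i => S (f i)) (fun s j =>
        if ((s =? t) && (j =? i))%bool then 0 else S (g s j)))].
      intros D P e _ _. cbn beta. rewrite update_shift. reflexivity.
  - apply definable_ex with (B := fun D P e x =>
      object (A D P (fun i => e (f i))) t x /\
      sat_within D (A D P (fun i => e (f i))) (U D P (fun i => e (f i)))
        (update (fun s j => e (g s j)) t i x) q).
    cbn beta. apply definable_and.
    + exact (definable_object t HA (fun i => S (f i)) 0).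
    + eapply definable_ext; [| exact (IH (fun i => S (f i)) (fun s j =>
        if ((s =? t) && (j =? i))%bool then 0 else S (g s j)))].
      intros D P e _ _. cbn beta. rewrite update_shift. reflexivity.
Qed.

(** Φ is expressed by a formula in finitely many variables, so it is applied to
    assignments that are constant from some index on. *)
Lemma definable_elementary (Φ : predicate) (D P D' P' : V -> Prop) (K : nat) e :
  definable Φ ->
  elementary_extension (Structure D (@mem V) P) (Structure D' (@mem V) P') ->
  transitive_class D -> transitive_class D' ->
  (forall i, D (e i)) -> (forall i, K <= i -> e i = e K) ->
  (Φ D P e <-> Φ D' P' e).
Proof.
  intros HΦ [HDD Hel] HD HD' He HK.
  destruct (HΦ (fun i => Nat.min i K)) as (p & Hp & Hsat).
  { exists (S K). intros i. lia. }
  specialize (Hel p (fun _ => e) Hp He). simpl in HDD.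
  rewrite (Hsat D P), (Hsat D' P') in Hel; auto.
  replace (fun i => e (Nat.min i K)) with e in Hel; trivial.
  apply functional_extensionality. intros i.
  destruct (Nat.le_ge_cases i K) as [H | H].
  - now rewrite Nat.min_l.
  - rewrite Nat.min_r by trivial. auto.
Qed.

(** * Collapsing a well-founded end elementary extension *)

(** Mostowski's collapse of M; it is injective if M is extensional. *)
Lemma collapsing_map (M : structure V) :
  set_sized M -> well_founded_structure M ->
  exists π : V -> V, forall m z,
    z ∈ π m <-> exists m', (dom M m' /\ dom M m /\ rel M m' m) /\ z = π m'.
Proof.
  intros [d Hd] Hwf. unfold well_founded_structure in Hwf.
  pose (R := fun x y => dom M x /\ dom M y /\ rel M x y).
  change (well_founded R) in Hwf.
  pose (F := fun m (rec : forall m', R m' m -> V) =>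
    the (fun y => forall z, z ∈ y <-> exists m' (H : R m' m), z = rec m' H)).
  exists (Fix Hwf (fun _ => V) F). intros m z. rewrite Fix_eq.
  - refine (iff_trans (the_spec (P := fun y => forall z, z ∈ y <-> exists m'
      (H : R m' m), z = Fix Hwf (fun _ => V) F m') _ z) _).
    + destruct (separation d (fun m' => R m' m)) as [s Hs].
      destruct (image_exists s (Fix Hwf (fun _ => V) F)) as [b Hb].
      exists b. intros y. rewrite Hb. split.
      * intros (m' & Hm' & ->). apply Hs in Hm' as [_ H]. exists m', H. reflexivity.
      * intros (m' & H & ->). exists m'. split; trivial. apply Hs.
        split; trivial. apply Hd, H.
    + split.
      * intros (m' & H & ->). exists m'. auto.
      * intros (m' & H & ->). exists m', H. reflexivity.
  - intros m' f g H. replace g with f; trivial.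
    apply functional_extensionality_dep. intros y.
    apply functional_extensionality_dep. intros Hy. apply H.
Qed.

Definition image_structure (M : structure V) (π : V -> V) : structure V :=
  Structure (fun x => exists m, dom M m /\ x = π m) (@mem V)
    (fun x => exists m, dom M m /\ x = π m /\ pred M m).

Lemma sat_isomorphism (M : structure V) (π : V -> V) :
  (forall m m', dom M m -> dom M m' -> π m = π m' -> m = m') ->
  (forall m m', dom M m -> dom M m' -> (rel M m m' <-> π m ∈ π m')) ->
  forall p r, first_order p -> (forall i, dom M (r 0 i)) ->
  sat M r p <-> sat (image_structure M π) (fun t i => π (r t i)) p.
Proof.
  intros Hinj Hrel p.
  assert (Hup : forall r t i x,
    (fun s j => π (update r t i x s j)) = update (fun s j => π (r s j)) t i (π x)).
  { intros r t i x. apply functional_extensionality. intros s.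
    apply functional_extensionality. intros j.
    unfold update. destruct (_ && _)%bool; reflexivity. }
  assert (Hdom : forall r i x, dom M x -> (forall j, dom M (r 0 j)) ->
    forall j, dom M (update r 0 i x 0 j)).
  { intros r i x Hx Hr j. unfold update. destruct (_ && _)%bool; auto. }
  induction p as [| i j | i | t i j | t i j | q IHq q' IHq' | t i q IH | t i q IH];
    intros r Hp Hr; cbn in Hp |- *.
  - tauto.
  - auto.
  - split; [eauto |]. intros (m & Hm & E & HP).
    rewrite (Hinj _ _ (Hr i) Hm E). exact HP.
  - assert (t = 0) as -> by lia. split; [congruence | auto].
  - lia.
  - rewrite (IHq r), (IHq' r) by (tauto || trivial). reflexivity.
  - destruct Hp as [Ht Hq]. assert (t = 0) as -> by lia. split.
    + intros H x (m & Hm & ->). rewrite <- Hup. apply IH; auto.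
    + intros H m Hm. apply IH; auto. rewrite Hup. apply H. exists m. auto.
  - destruct Hp as [Ht Hq]. assert (t = 0) as -> by lia. split.
    + intros (m & Hm & H). exists (π m). split; [exists m; auto |].
      rewrite <- Hup. apply IH; auto.
    + intros (x & (m & Hm & ->) & H). exists m. split; trivial.
      apply IH; auto. rewrite Hup. exact H.
Qed.

Lemma extensional_extension (D P : V -> Prop) (M : structure V) :
  transitive_class D -> (exists a, D a) ->
  elementary_extension (Structure D (@mem V) P) M ->
  forall x y, dom M x -> dom M y ->
  (forall z, dom M z -> (rel M z x <-> rel M z y)) -> x = y.
Proof.
  intros HD [a Ha] [_ Hel] x y Hx Hy H.
  specialize (Hel (All 0 0 (All 0 1 (Imp (All 0 2 (Imp (Rel 2 0) (Rel 2 1)))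
    (Imp (All 0 2 (Imp (Rel 2 1) (Rel 2 0))) (Eq 0 0 1))))) (fun _ _ => a)).
  cbn in Hel. refine (proj1 (Hel _ _) _ x Hx y Hy _ _); trivial.
  - lia.
  - intros u Hu v Hv H1 H2. apply set_ext. intros z. split; eauto.
  - intros z Hz. apply H; trivial.
  - intros z Hz. apply H; trivial.
Qed.

(** The collapse is the identity on D because no element of D gets new
    elements.  It sends the ordinals of M, which are isomorphic to the height
    h, to true ordinals, so it is the inverse of that isomorphism. *)
Lemma transitive_end_extension (D P : V -> Prop) (M : structure V) :
  transitive_class D -> (exists a, D a) ->
  set_sized M -> well_founded_structure M ->
  end_elementary_extension (Structure D (@mem V) P) M ->
  exists D' P' : V -> Prop, transitive_class D' /\
    elementary_extension (Structure D (@mem V) P) (Structure D' (@mem V) P') /\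
    forall h, height M h -> forall a, a ∈ h -> D' a.
Proof.
  intros HD Hne Hset Hwf (Hel & _ & Hend).
  destruct (collapsing_map Hset Hwf) as [π Hπ].
  pose proof (extensional_extension HD Hne Hel) as Hext.
  assert (Hinj : forall m, forall m', dom M m -> dom M m' -> π m = π m' -> m = m').
  { intros m. induction (Hwf m) as [m _ IH]. intros m' Hm Hm' E.
    apply Hext; trivial. intros z Hz. split; intros Hr.
    - assert (Hin : π z ∈ π m') by (rewrite <- E; apply Hπ; eauto).
      apply Hπ in Hin as (z' & (Hz' & _ & Hr') & Ez).
      rewrite (IH z (conj Hz (conj Hm Hr)) z' Hz Hz' Ez). exact Hr'.
    - assert (Hin : π z ∈ π m) by (rewrite E; apply Hπ; eauto).
      apply Hπ in Hin as (z' & (Hz' & _ & Hr') & Ez).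
      rewrite <- (IH z' (conj Hz' (conj Hm Hr')) z Hz' Hz (eq_sym Ez)). exact Hr'. }
  assert (Hrel : forall m m', dom M m -> dom M m' -> (rel M m m' <-> π m ∈ π m')).
  { intros m m' Hm Hm'. rewrite Hπ. split; [eauto |].
    intros (z & (Hz & _ & Hr) & E). rewrite (Hinj m z Hm Hz E). exact Hr. }
  assert (Hid : forall x, D x -> π x = x).
  { intros x. induction x as [x IH] using mem_ind. intros Hx.
    apply set_ext. intros z. rewrite Hπ. split.
    - intros (m & (Hm & _ & Hr) & ->).
      destruct (proj2 (Hend x m Hx) (conj Hm Hr)) as [Hmd Hmx].
      rewrite (IH m Hmx Hmd). exact Hmx.
    - intros Hz. assert (Hzd : D z) by exact (HD x z Hx Hz).
      exists z. destruct (proj1 (Hend x z Hx) (conj Hzd Hz)) as [Hzm Hr].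
      rewrite (IH z Hz Hzd). repeat split; trivial.
      exact (proj1 Hel x Hx). }
  exists (dom (image_structure M π)), (pred (image_structure M π)).
  split; [| split; [split |]].
  - intros x y (m & Hm & ->) Hy. apply Hπ in Hy as (m' & (Hm' & _) & ->).
    exists m'. auto.
  - intros x Hx. exists x. split; [exact (proj1 Hel x Hx) | symmetry; auto].
  - intros p r Hp Hr.
    assert (HrM : forall i, dom M (r 0 i)) by (intros i; apply (proj1 Hel), Hr).
    rewrite (proj2 Hel p r Hp Hr), (sat_isomorphism Hinj Hrel Hp HrM).
    apply sat_first_order; trivial. intros i _. apply Hid, Hr.
  - intros h (Oh & f & Hf & _ & Hsurj & Hord) a Ha.
    enough (E : forall a, a ∈ h -> π (f a) = a).
    { exists (f a). split; [apply (Hf a Ha) | symmetry; auto]. }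
    clear a Ha. intros a. induction a as [a IH] using mem_ind. intros Ha.
    apply set_ext. intros z. rewrite Hπ. split.
    + intros (m & (Hm & _ & Hr) & ->).
      assert (Om : ordinal_in M m).
      { destruct (Hf a Ha) as (_ & Ht & He). split; [exact Hm |].
        split; [exact (He m Hm Hr) |]. intros y Hy Hym.
        apply He; trivial. exact (Ht m y Hm Hy Hr Hym). }
      destruct (Hsurj m Om) as (b & Hb & <-).
      assert (Hba : b ∈ a) by (apply Hord; trivial).
      rewrite (IH b Hba Hb). exact Hba.
    + intros Hz. assert (Hzh : z ∈ h) by exact (proj1 Oh a Ha z Hz).
      exists (f z). split; [| symmetry; auto]. split; [apply (Hf z Hzh) |].
      split; [apply (Hf a Ha) |]. apply Hord; trivial.
Qed.

(** * The universe below an inaccessible cardinal *)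

Section Inaccessible.

Context (k : V) (Hk : inaccessible k).

Lemma inaccessible_ordinal : ordinal k.
Proof. apply Hk. Qed.

Lemma inaccessible_nonempty : exists a, a ∈ k /\ ~ empty a.
Proof.
  destruct Hk as (_ & Hu & _). apply NNPP. intros Hn. apply Hu.
  exists (fun _ => 0). intros x y Hx Hy _. apply empty_unique.
  - apply NNPP. intros He. apply Hn. eauto.
  - apply NNPP. intros He. apply Hn. eauto.
Qed.

(** Regularity for a constant function on a nonempty set. *)
Lemma inaccessible_limit (a : V) : a ∈ k -> exists b, b ∈ k /\ a ∈ b.
Proof.
  intros Ha. destruct inaccessible_nonempty as (c & Hc & Hne).
  destruct Hk as (_ & _ & Hr & _).
  destruct (Hr c (fun _ => a) Hc) as (b & Hb & H); [auto |].
  exists b. split; trivial. apply NNPP. intros Hn. apply Hne.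
  intros z Hz. exact (Hn (H z Hz)).
Qed.

Lemma inaccessible_num (n : nat) : num n ∈ k.
Proof.
  pose proof inaccessible_ordinal as Ok. induction n as [| n IH].
  - destruct inaccessible_nonempty as (a & Ha & _).
    assert (Oa : ordinal (num 0))
      by (split; intros y Hy; destruct (num_zero Hy)).
    destruct (ordinal_subset Oa Ok) as [E | H]; trivial.
    + intros z Hz. destruct (num_zero Hz).
    + rewrite <- E in Ha. destruct (num_zero Ha).
  - destruct (inaccessible_limit IH) as (b & Hb & Hn).
    assert (Ob : ordinal b) by exact (ordinal_mem Ok Hb).
    assert (On : ordinal (num (S n)))
      by exact (ordinal_succ (ordinal_mem Ok IH) (num_succ n)).
    destruct (ordinal_subset On Ob) as [E | H].
    + intros z Hz. apply num_succ in Hz as [Hz | ->]; trivial.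
      exact (proj1 Ob (num n) Hn z Hz).
    + rewrite E. exact Hb.
    + exact (proj1 Ok b Hb _ H).
Qed.

Lemma inaccessible_omega (w : V) :
  (forall x, x ∈ w <-> exists n, x = num n) -> w ∈ k.
Proof.
  intros Hw. pose proof inaccessible_ordinal as Ok.
  assert (Hsub : w ⊆ k).
  { intros x Hx. apply Hw in Hx as [n ->]. apply inaccessible_num. }
  assert (Hnum : forall n z, z ∈ num n -> z ∈ w).
  { induction n as [| n IH]; intros z Hz.
    - destruct (num_zero Hz).
    - apply num_succ in Hz as [Hz | ->]; [auto |]. apply Hw. eauto. }
  assert (Ow : ordinal w).
  { split.
    - intros x Hx z Hz. apply Hw in Hx as [n ->]. eauto.
    - intros x Hx. exact (proj1 (ordinal_mem Ok (Hsub x Hx))). }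
  destruct (ordinal_subset Ow Ok Hsub) as [-> | H]; trivial.
  destruct Hk as (_ & Hu & _). exfalso. apply Hu.
  exists (fun x => epsilon (inhabits 0) (fun n => x = num n)).
  intros x y Hx Hy E. apply Hw in Hx, Hy.
  apply (epsilon_spec (inhabits 0)) in Hx, Hy. rewrite Hx, Hy. now rewrite E.
Qed.

Lemma rank_lt_bound (x : V) : rank_lt k x -> exists b, b ∈ k /\ rank_lt b x.
Proof.
  rewrite rank_lt_iff. intros (b & Hb & Hx).
  destruct (inaccessible_limit Hb) as (c & Hc & Hbc).
  exists c. split; trivial. econstructor; eauto.
Qed.

Lemma rank_lt_upair (z u v : V) :
  is_upair z u v -> rank_lt k u -> rank_lt k v -> rank_lt k z.
Proof.
  intros Hz Hu Hv. apply rank_lt_bound in Hu as (b & Hb & Hu).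
  apply rank_lt_bound in Hv as (c & Hc & Hv).
  pose proof inaccessible_ordinal as Ok.
  assert (H : exists d, d ∈ k /\ b ⊆ d /\ c ⊆ d).
  { destruct (ordinal_trichotomy (ordinal_mem Ok Hb) (ordinal_mem Ok Hc))
      as [H | [-> | H]].
    - exists c. split; trivial. split; [| intros ?; trivial].
      exact (proj1 (ordinal_mem Ok Hc) b H).
    - exists c. split; trivial. split; intros ?; trivial.
    - exists b. split; trivial. split; [intros ?; trivial |].
      exact (proj1 (ordinal_mem Ok Hb) c H). }
  destruct H as (d & Hd & Hbd & Hcd). econstructor; [exact Hd |].
  intros w Hw. apply (upair_in Hz) in Hw as [-> | ->].
  - exact (rank_lt_mono Hbd Hu).
  - exact (rank_lt_mono Hcd Hv).
Qed.

Lemma rank_lt_pair (p u v : V) :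
  is_pair p u v -> rank_lt k u -> rank_lt k v -> rank_lt k p.
Proof.
  intros ((a & Ha & Hau) & (b & Hb & Hbu) & H) Hu Hv.
  apply (rank_lt_upair (u := a) (v := b)).
  - split; [| split]; trivial. intros w Hw. destruct (H w Hw) as [K | K].
    + left. apply set_ext. intros z. rewrite (upair_in K), (upair_in Hau). tauto.
    + right. apply set_ext. intros z. rewrite (upair_in K), (upair_in Hbu). tauto.
  - exact (rank_lt_upair Hau Hu Hu).
  - exact (rank_lt_upair Hbu Hu Hv).
Qed.

Lemma rank_lt_class (b x : V) :
  rank_lt k b -> (forall z, z ∈ x -> rank_lt b z) -> rank_lt k x.
Proof.
  intros Hb Hx. apply rank_lt_bound in Hb as (c & Hc & Hb).
  econstructor; [exact Hc |]. intros z Hz. exact (rank_lt_trans Hb (Hx z Hz)).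
Qed.

Lemma rank_lt_object (a : V) (t : nat) : a ∈ k ->
  forall x, object (rank_lt a) t x -> rank_lt k x.
Proof.
  intros Ha.
  enough (H : exists b, b ∈ k /\ forall x, object (rank_lt a) t x -> rank_lt b x).
  { destruct H as (b & Hb & H). intros x Hx.
    exact (rank_lt_trans (rank_lt_mem Hb) (H x Hx)). }
  induction t as [| t (b & Hb & IH)]; [exists a; auto |].
  destruct (inaccessible_limit Hb) as (c & Hc & Hbc).
  exists c. split; trivial. intros x Hx. econstructor; [exact Hbc | auto].
Qed.

(** * Coding ranks and constructibility by one predicate *)

(** A ternary relation is coded by the unary predicate P of the triples
    s = (c, (b, x)); t is the inner pair. *)
Definition decode (D P : V -> Prop) (c b x : V) : Prop :=
  exists t, D t /\ exists s, D s /\ (P s /\ is_pair t b x /\ is_pair s c t).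

Lemma definable_decode (i j l : nat) :
  definable (fun D P e => decode D P (e i) (e j) (e l)).
Proof. unfold decode, is_pair, is_upair. definability. Qed.

Lemma decode_mem (D P : V -> Prop) (c b x : V) :
  transitive_class D -> decode D P c b x -> D x.
Proof.
  intros HD (t & Ht & _ & _ & _ & Hp & _). exact (proj2 (pair_mem HD Hp Ht)).
Qed.

(** 0, 1 and 2 are the tags of the other coded relations. *)
Definition form_tag (q : form) : V := num (3 + form_code q).

(** The tag c tells which relation between b and x is meant; for the unary
    relation x ∈ U, the place of b is filled by x. *)
Definition coded (U c b x : V) : Prop :=
  (c = num 0 /\ x ∈ U /\ b = x) \/
  (c = num 1 /\ rank_lt b x) \/
  (c = num 2 /\ Lset b x) \/
  exists q, c = form_tag q /\
    exists r, parameters_in (Lset b) q r /\ defined_by (Lset b) q r x.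

Lemma coded_pred (U x : V) : coded U (num 0) x x <-> x ∈ U.
Proof.
  split; [| left; auto].
  intros [(_ & H & _) | [(H & _) | [(H & _) | (q & H & _)]]]; trivial;
    apply num_inj in H; discriminate H.
Qed.

Lemma coded_rank (U b x : V) : coded U (num 1) b x <-> rank_lt b x.
Proof.
  split; [| right; left; auto].
  intros [(H & _) | [(_ & H) | [(H & _) | (q & H & _)]]]; trivial;
    apply num_inj in H; discriminate H.
Qed.

Lemma coded_level (U b x : V) : coded U (num 2) b x <-> Lset b x.
Proof.
  split; [| right; right; left; auto].
  intros [(H & _) | [(H & _) | [(_ & H) | (q & H & _)]]]; trivial;
    apply num_inj in H; discriminate H.
Qed.

Lemma coded_form (U b x : V) q : coded U (form_tag q) b x <->
  exists r, parameters_in (Lset b) q r /\ defined_by (Lset b) q r x.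
Proof.
  split; [| right; right; right; eauto].
  intros [(H & _) | [(H & _) | [(H & _) | (q' & H & Hr)]]];
    apply num_inj in H; try discriminate H.
  assert (q = q') as -> by (apply form_code_inj; lia). exact Hr.
Qed.

Definition codes (U S : V) : Prop := forall s, s ∈ S <->
  rank_lt k s /\ exists c b x, is_triple s c b x /\ coded U c b x.

Lemma codes_exist (U : V) : exists S, codes U S.
Proof.
  destruct (rank_set_exists k) as [v Hv].
  destruct (separation v (fun s => exists c b x,
    is_triple s c b x /\ coded U c b x)) as [S HS].
  exists S. intros s. now rewrite HS, Hv.
Qed.

Lemma decode_below (U S c b x : V) : codes U S ->
  rank_lt k c -> rank_lt k b -> rank_lt k x ->
  decode (rank_lt k) (fun s => s ∈ S /\ rank_lt k s) c b x <-> coded U c b x.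
Proof.
  intros HS Hc Hb Hx. split.
  - intros (t & _ & s & _ & (Hs & _) & Ht & Hst).
    apply HS in Hs as (_ & c' & b' & x' & Hs & H).
    assert (Hs' : is_triple s c b x) by (exists t; auto).
    destruct (triple_inj Hs Hs') as (-> & -> & ->). exact H.
  - intros H. destruct (pair_exists b x) as [t Ht].
    destruct (pair_exists c t) as [s Hs].
    assert (Hkt := rank_lt_pair Ht Hb Hx). assert (Hks := rank_lt_pair Hs Hc Hkt).
    exists t. split; trivial. exists s. split; trivial.
    repeat split; try apply Ht; try apply Hs; trivial.
    apply HS. split; trivial. exists c, b, x. split; trivial. exists t. auto.
Qed.

Lemma rank_lt_num (n : nat) : rank_lt k (num n).
Proof. apply rank_lt_mem, inaccessible_num. Qed.

Lemma rank_lt_transitive_class (a : V) : transitive_class (rank_lt a).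
Proof. intros x y. apply rank_lt_transitive. Qed.

Lemma decode_rank_below (U S b : V) : codes U S -> rank_lt k b ->
  decode (rank_lt k) (fun s => s ∈ S /\ rank_lt k s) (num 1) b = rank_lt b.
Proof.
  intros HS Hb. apply class_ext. intros x. split; intros H.
  - assert (Hx := decode_mem (@rank_lt_transitive_class k) H).
    apply (decode_below HS (rank_lt_num 1) Hb Hx), coded_rank in H. exact H.
  - assert (Hx := rank_lt_trans Hb H).
    apply (decode_below HS (rank_lt_num 1) Hb Hx), coded_rank, H.
Qed.

Lemma decode_level_below (U S b : V) : codes U S -> rank_lt k b ->
  decode (rank_lt k) (fun s => s ∈ S /\ rank_lt k s) (num 2) b = Lset b.
Proof.
  intros HS Hb. apply class_ext. intros x. split; intros H.
  - assert (Hx := decode_mem (@rank_lt_transitive_class k) H).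
    apply (decode_below HS (rank_lt_num 2) Hb Hx), coded_level in H. exact H.
  - assert (Hx := rank_lt_trans Hb (Lset_rank H)).
    apply (decode_below HS (rank_lt_num 2) Hb Hx), coded_level, H.
Qed.

(** * First-order recursion clauses for the coded relations *)

(** In the clauses, e 0 and e 1 are constants: tags, except that e 1 is the set
    of all tags of formulas in [level_clause]. *)
Definition rank_clause (D P : V -> Prop) (e : nat -> V) : Prop :=
  forall a, D a -> forall x, D x ->
  (decode D P (e 0) a x <->
   exists b, b ∈ a /\ forall y, y ∈ x -> decode D P (e 0) b y).

Definition level_clause (D P : V -> Prop) (e : nat -> V) : Prop :=
  forall b, D b -> forall x, D x ->
  (decode D P (e 0) b x <->
   exists c, c ∈ b /\ exists n, n ∈ e 1 /\ decode D P n c x).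

(** Makes a relation depend on the values u 0, ..., u K only. *)
Definition truncate (K : nat) (u : nat -> V) (i : nat) : V := u (Nat.min i K).

Definition defined_within (D A : V -> Prop) (q : form) (u : nat -> V) (x : V) : Prop :=
  forall z, D z -> (z ∈ x <-> A z /\
    sat_within D A (fun _ => False) (update (fun _ => u) 0 0 z) q).

Definition form_clause (q : form) (K : nat) (D P : V -> Prop) (e : nat -> V) : Prop :=
  forall b, D b -> forall x, D x ->
  (decode D P (e 0) b x <-> exists u, (forall i, D (u i)) /\
    (parameters_in (decode D P (e 1) b) q (truncate K u) /\
     defined_within D (decode D P (e 1) b) q (truncate K u) x)).

Definition comprehension_clause (q : form) (K : nat) (D P : V -> Prop) (e : nat -> V)
  : Prop :=
  forall b, D b -> forall u, (forall i, D (u i)) ->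
  parameters_in (decode D P (e 1) b) q (truncate K u) ->
  exists x, D x /\ defined_within D (decode D P (e 1) b) q (truncate K u) x.

Lemma definable_rank_clause : definable rank_clause.
Proof. unfold rank_clause. definability. Qed.

Lemma definable_level_clause : definable level_clause.
Proof. unfold level_clause. definability. Qed.

Lemma definable_parameters_in (i j : nat) (q : form) (K : nat) :
  definable (fun D P e =>
    parameters_in (decode D P (e i) (e j)) q (truncate K e)).
Proof.
  destruct (free_bounded q) as [N HN].
  eapply definable_ext; [| apply (@definable_forall_nat (fun m D P e =>
    (free 0 m q /\ m <> 0) -> decode D P (e i) (e j) (e (Nat.min m K))) N)].
  - intros D P e _ _. unfold parameters_in, truncate. split.
    + intros H m Hf Hm. apply H; eauto.
    + intros H m _ [Hf Hm]. auto.
  - intros m. apply definable_imp; [apply definable_const | apply definable_decode].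
Qed.

Lemma definable_defined_within (i j l : nat) (q : form) (K : nat) (f : nat -> nat) :
  definable (fun D P e =>
    defined_within D (decode D P (e i) (e j)) q
      (truncate K (fun m => e (f m))) (e l)).
Proof.
  unfold defined_within. definability.
  eapply definable_ext; [| apply (@definable_sat_within
      (fun D P e z => decode D P (e i) (e j) z) (fun D P e z => False) q
      (definable_decode _ _ _) (definable_const _) S
      (fun t m => if ((t =? 0) && (m =? 0))%bool then 0 else S (f (Nat.min m K))))].
  intros D P e _ _. cbn beta. rewrite <- update_shift. reflexivity.
Qed.

Lemma truncate_agree (K : nat) (u v : nat -> V) :
  (forall i, i < S K -> u i = v i) -> truncate K u = truncate K v.
Proof.
  intros H. apply functional_extensionality. intros i. apply H. lia.
Qed.

Lemma definable_form_clause (q : form) (K : nat) : definable (form_clause q K).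
Proof.
  unfold form_clause. apply definable_all, definable_all. cbn beta.
  apply definable_iff; [apply definable_decode |].
  apply (@definable_ex_block (S K) (fun D P e u =>
    parameters_in (decode D P (e 3) (e 1)) q (truncate K u) /\
    defined_within D (decode D P (e 3) (e 1)) q (truncate K u) (e 0))).
  - intros D P e u v H. now rewrite (truncate_agree H).
  - apply definable_and.
    + apply definable_parameters_in.
    + exact (definable_defined_within (S K + 3) (S K + 1) (S K + 0) q K (fun m => m)).
Qed.

Lemma definable_comprehension_clause (q : form) (K : nat) :
  definable (comprehension_clause q K).
Proof.
  unfold comprehension_clause. apply definable_all. cbn beta.
  apply (@definable_all_block (S K) (fun D P e u =>
    parameters_in (decode D P (e 2) (e 0)) q (truncate K u) ->
    exists x, D x /\
      defined_within D (decode D P (e 2) (e 0)) q (truncate K u) x)).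
  - intros D P e u v H. now rewrite (truncate_agree H).
  - apply definable_imp; [apply definable_parameters_in |].
    apply definable_ex with (B := fun D P e x =>
      defined_within D (decode D P (e (S K + 2)) (e (S K + 0))) q (truncate K e) x).
    cbn beta.
    exact (definable_defined_within (S (S K + 2)) (S (S K + 0)) 0 q K S).
Qed.

Definition env2 (a b : V) (i : nat) : V := match i with 0 => a | _ => b end.

Lemma defined_within_iff (D A : V -> Prop) (q : form) (u : nat -> V) (x : V) :
  transitive_class D -> (forall z, A z -> D z) -> first_order q -> D x ->
  defined_within D A q u x <-> defined_by A q u x.
Proof.
  intros HD HA Hq Hx.
  assert (E : forall r, sat_within D A (fun _ => False) r q <->
      sat (Structure A (@mem V) (fun _ => False)) r q).
  { apply sat_within_sat with (n := 0); trivial.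
    intros t y Ht. replace t with 0 by lia. apply HA. }
  split; intros H z.
  - split.
    + intros Hz. rewrite <- E. apply H; eauto.
    + intros Hz. rewrite <- E in Hz. apply H; trivial. apply HA, Hz.
  - intros _. rewrite E. apply H.
Qed.

Lemma truncate_parameters (D A : V -> Prop) (d : V) (q : form) (K : nat) (r : nat -> V) :
  (forall z, A z -> D z) -> D d -> first_order q ->
  (forall t i, free t i q -> i < K) -> parameters_in A q r ->
  exists u, (forall i, D (u i)) /\ parameters_in A q (truncate K u) /\
    forall x, defined_by A q r x <-> defined_by A q (truncate K u) x.
Proof.
  intros HA Hd Hq HK Hr.
  exists (fun i => if excluded_middle_informative (free 0 i q /\ i <> 0)
                   then r i else d).
  set (u := fun i => _).
  assert (E : forall i, free 0 i q -> i <> 0 -> truncate K u i = r i).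
  { intros i Hf Hi. unfold truncate, u. specialize (HK 0 i Hf).
    rewrite Nat.min_l by lia.
    destruct (excluded_middle_informative _); tauto. }
  split; [| split].
  - intros i. unfold u. destruct (excluded_middle_informative _) as [[Hf Hi] |]; auto.
  - intros i Hf Hi. rewrite E by trivial. auto.
  - intros x.
    assert (Es : forall z, sat (Structure A (@mem V) (fun _ => False))
        (update (fun _ => r) 0 0 z) q <->
      sat (Structure A (@mem V) (fun _ => False))
        (update (fun _ => truncate K u) 0 0 z) q).
    { intros z. apply sat_first_order; trivial. intros i Hf. unfold update. simpl.
      destruct (Nat.eqb_spec i 0); trivial. symmetry. auto. }
    split; intros H z; rewrite (H z), Es; reflexivity.
Qed.

Definition form_tags (T : V) : Prop :=
  forall n, n ∈ T <-> exists q, first_order q /\ n = form_tag q.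

Lemma form_tags_exist : exists T, form_tags T /\ rank_lt k T.
Proof.
  destruct omega_exists as [w Hw].
  destruct (separation w (fun n => exists q, first_order q /\ n = form_tag q))
    as [T HT].
  exists T. split.
  - intros n. rewrite HT. split; [tauto |]. intros (q & Hq & ->).
    split; [apply Hw; unfold form_tag |]; eauto.
  - econstructor; [exact (inaccessible_omega Hw) |].
    intros y Hy. apply rank_lt_mem, HT, Hy.
Qed.

Section Transfer.

Context (U S T : V) (HS : codes U S) (HT : form_tags T) (HTk : rank_lt k T).

Local Notation W := (rank_lt k).
Local Notation PW := (fun s => s ∈ S /\ rank_lt k s).

Lemma rank_clause_below : rank_clause W PW (env2 (num 1) (num 1)).
Proof.
  intros a Ha x Hx. simpl. rewrite (decode_rank_below HS Ha).
  rewrite rank_lt_iff.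
  assert (E : forall b, b ∈ a -> decode W PW (num 1) b = rank_lt b).
  { intros b Hb. exact (decode_rank_below HS (rank_lt_transitive Ha Hb)). }
  split; intros (b & Hb & H); exists b; split; trivial; intros y Hy;
    specialize (H y Hy); rewrite (E b Hb) in *; trivial.
Qed.

Lemma decode_form_below (q : form) (b x : V) : W b -> W x ->
  decode W PW (form_tag q) b x <->
  exists r, parameters_in (Lset b) q r /\ defined_by (Lset b) q r x.
Proof.
  intros Hb Hx. rewrite <- (coded_form U).
  exact (decode_below HS (rank_lt_num _) Hb Hx).
Qed.

Lemma level_clause_below : level_clause W PW (env2 (num 2) T).
Proof.
  intros b Hb x Hx. simpl. rewrite (decode_level_below HS Hb).
  rewrite Lset_iff. split.
  - intros (c & Hc & H). exists c. split; trivial.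
    apply definable_subset_iff in H as (q & r & Hq & Hr & H).
    exists (form_tag q). split; [apply HT; eauto |].
    apply decode_form_below; eauto. exact (rank_lt_transitive Hb Hc).
  - intros (c & Hc & n & Hn & H). exists c. split; trivial.
    apply HT in Hn as (q & Hq & ->).
    apply decode_form_below in H as (r & Hr & H); trivial.
    + apply definable_subset_iff. eauto.
    + exact (rank_lt_transitive Hb Hc).
Qed.

Lemma Lset_below (b z : V) : W b -> Lset b z -> W z.
Proof. intros Hb Hz. exact (rank_lt_trans Hb (Lset_rank Hz)). Qed.

Lemma form_clause_below (q : form) (K : nat) :
  first_order q -> (forall t i, free t i q -> i < K) ->
  form_clause q K W PW (env2 (form_tag q) (num 2)).
Proof.
  intros Hq HK b Hb x Hx. simpl. rewrite (decode_form_below q Hb Hx).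
  rewrite (decode_level_below HS Hb). split.
  - intros (r & Hr & H).
    destruct (@truncate_parameters W (Lset b) b q K r) as (u & Hu & Hp & E); trivial.
    { intros z. apply Lset_below, Hb. }
    exists u. split; [exact Hu |]. split; [exact Hp |].
    apply defined_within_iff; trivial.
    + apply rank_lt_transitive_class.
    + intros z. apply Lset_below, Hb.
    + apply E, H.
  - intros (u & _ & Hp & H). exists (truncate K u). split; trivial.
    apply defined_within_iff in H; trivial.
    + apply rank_lt_transitive_class.
    + intros z. apply Lset_below, Hb.
Qed.

Lemma comprehension_clause_below (q : form) (K : nat) : first_order q ->
  comprehension_clause q K W PW (env2 (num 2) (num 2)).
Proof.
  intros Hq b Hb u _ _. simpl.
  rewrite (decode_level_below HS Hb).
  destruct (rank_set_exists b) as [v Hv].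
  destruct (separation v (fun z => Lset b z /\
    sat (Structure (Lset b) (@mem V) (fun _ => False))
      (update (fun _ => truncate K u) 0 0 z) q)) as [x Hx].
  assert (HWx : W x).
  { apply (rank_lt_class Hb). intros z Hz. apply Hv, Hx, Hz. }
  exists x. split; trivial. apply defined_within_iff; trivial.
  - apply rank_lt_transitive_class.
  - intros z. apply Lset_below, Hb.
  - intros z. rewrite Hx. split; [tauto |]. intros Hz. split; trivial.
    apply Hv, Lset_rank, Hz.
Qed.

(** ** The same recursion in an elementary extension *)

Context (D P : V -> Prop) (HD : transitive_class D)
  (Hel : elementary_extension (Structure W (@mem V) PW) (Structure D (@mem V) P)).

Lemma elementary_env2 (Φ : predicate) (a b : V) : definable Φ -> W a -> W b ->
  (Φ W PW (env2 a b) <-> Φ D P (env2 a b)).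
Proof.
  intros HΦ Ha Hb. apply (definable_elementary (K := 1)); trivial.
  - apply rank_lt_transitive_class.
  - intros [| i]; trivial.
  - intros [| i]; simpl; [lia | trivial].
Qed.

Lemma decode_rank (a : V) :
  D a -> forall x, D x -> (decode D P (num 1) a x <-> rank_lt a x).
Proof.
  pose proof (proj1 (elementary_env2 definable_rank_clause (rank_lt_num 1)
    (rank_lt_num 1)) rank_clause_below) as H.
  induction a as [a IH] using mem_ind. intros Ha x Hx.
  rewrite (H a Ha x Hx), rank_lt_iff. simpl.
  split; intros (b & Hb & Hy); exists b; split; trivial; intros y Hyx;
    apply (IH b Hb); eauto.
Qed.

(** If L_c is computed correctly for c ∈ b, then so is definability over L_c by
    each formula, whence L_b.  A set definable over L_c belongs to D by the
    comprehension clause, and a tag in D is the tag of a formula because it is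
    an element of T. *)
Lemma decode_level (b : V) : D b -> decode D P (num 2) b = Lset b.
Proof.
  pose proof (proj1 (elementary_env2 definable_level_clause (rank_lt_num 2)
    HTk) level_clause_below) as Hlevel.
  induction b as [b IH] using mem_ind. intros Hb.
  assert (HLD : forall c, c ∈ b -> forall z, Lset c z -> D z).
  { intros c Hc z. rewrite <- (IH c Hc (HD Hb Hc)). apply (decode_mem HD). }
  assert (Hform : forall q K, first_order q -> (forall t i, free t i q -> i < K) ->
    forall c, c ∈ b -> forall x, D x -> (decode D P (form_tag q) c x <->
      exists u, (forall i, D (u i)) /\ parameters_in (Lset c) q (truncate K u) /\
        defined_by (Lset c) q (truncate K u) x)).
  { intros q K Hq HK c Hc x Hx.
    pose proof (proj1 (elementary_env2 (definable_form_clause q K)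
      (rank_lt_num _) (rank_lt_num 2)) (form_clause_below Hq HK)) as H.
    specialize (H c (HD Hb Hc) x Hx). simpl in H.
    rewrite (IH c Hc (HD Hb Hc)) in H. unfold form_tag. rewrite H.
    split; intros (u & Hu & Hp & Hd); exists u; split; trivial; split; trivial;
      apply (defined_within_iff (truncate K u) HD (HLD c Hc) Hq Hx), Hd. }
  apply class_ext. intros x. rewrite Lset_iff. split.
  - intros H. assert (Hx : D x) by exact (decode_mem HD H).
    apply (Hlevel b Hb x Hx) in H as (c & Hc & n & Hn & H). simpl in Hn.
    exists c. split; trivial. apply HT in Hn as (q & Hq & ->).
    destruct (free_bounded q) as [K HK].
    apply (Hform q K Hq HK c Hc x Hx) in H as (u & _ & Hp & H).
    apply definable_subset_iff. eauto.
  - intros (c & Hc & H). apply definable_subset_iff in H as (q & r & Hq & Hr & H).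
    destruct (free_bounded q) as [K HK].
    destruct (truncate_parameters (HLD c Hc) Hb Hq HK Hr) as (u & Hu & Hp & E).
    apply E in H.
    assert (Hx : D x).
    { pose proof (proj1 (elementary_env2 (definable_comprehension_clause q K)
        (rank_lt_num 2) (rank_lt_num 2)) (comprehension_clause_below (K := K) Hq)) as Hc'.
      specialize (Hc' c (HD Hb Hc) u Hu). simpl in Hc'.
      rewrite (IH c Hc (HD Hb Hc)) in Hc'.
      destruct (Hc' Hp) as (x' & Hx' & Hd).
      apply (defined_within_iff (truncate K u) HD (HLD c Hc) Hq Hx') in Hd.
      replace x with x'; trivial. apply set_ext. intros z.
      rewrite (Hd z), (H z). reflexivity. }
    apply (Hlevel b Hb x Hx). exists c. split; trivial.
    exists (form_tag q). split; [apply HT; eauto |].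
    apply (Hform q K Hq HK c Hc x Hx). eauto.
Qed.

(** * Reflection of a true sentence *)

(** p is true in (V_a, ∈, U), as far as the quantifiers over D can tell.
    A constant assignment will do because p is going to be a sentence. *)
Definition true_at (p : form) (D P : V -> Prop) (e : nat -> V) (a : V) : Prop :=
  sat_within D (decode D P (e 1) a)
    (fun x => decode D P (e 0) x x /\ decode D P (e 1) a x) (fun _ _ => e 0) p.

(** The conjunct [True] gives the bounded quantifier the form that
    [definable_bex] expects. *)
Definition true_below (p : form) (D P : V -> Prop) (e : nat -> V) : Prop :=
  exists a, D a /\ (ordinal a /\ (exists y, y ∈ a /\ True) /\ true_at p D P e a).

Lemma definable_true_below (p : form) : definable (true_below p).
Proof.
  unfold true_below. apply definable_ex. cbn beta.
  apply definable_and; [apply definable_ordinal |].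
  apply definable_and; [definability |].
  exact (definable_sat_within
    (A := fun D P e x => decode D P (e 2) (e 0) x)
    (U := fun D P e x => decode D P (e 1) x x /\ decode D P (e 2) (e 0) x) p
    (definable_decode _ _ _)
    (definable_and (definable_decode _ _ _) (definable_decode _ _ _))
    (fun i => i) (fun _ _ => 1)).
Qed.

Lemma decode_pred_below (x : V) : W x -> (decode W PW (num 0) x x <-> x ∈ U).
Proof.
  intros Hx.
  rewrite (decode_below HS (rank_lt_num 0) Hx Hx). apply coded_pred.
Qed.

Lemma decode_pred (x : V) : W x -> (decode D P (num 0) x x <-> x ∈ U).
Proof.
  intros Hx. rewrite <- decode_pred_below by trivial. symmetry.
  exact (elementary_env2 (definable_decode 0 1 1) (rank_lt_num 0) Hx).
Qed.

Lemma true_at_iff (p : form) (n : nat) (D' P' : V -> Prop) (a : V) (r : nat -> nat -> V) :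
  has_order (Datatypes.S n) p -> sentence p ->
  (forall x, decode D' P' (num 1) a x <-> rank_lt a x) ->
  (forall x, rank_lt a x -> (decode D' P' (num 0) x x <-> x ∈ U)) ->
  (forall t x, t <= n -> object (rank_lt a) t x -> D' x) ->
  true_at p D' P' (env2 (num 0) (num 1)) a <-> sat (rank_structure a U) r p.
Proof.
  intros Hp Hs Hrank HU Hobj. unfold true_at. simpl.
  rewrite (class_ext Hrank).
  rewrite (class_ext (P := fun x => decode D' P' (num 0) x x /\ rank_lt a x)
    (Q := fun x => x ∈ U /\ rank_lt a x)).
  - rewrite (sat_within_sat _ Hobj Hp).
    apply sat_agree. intros t i Hf. destruct (Hs t i Hf).
  - intros x. split; intros [H H']; split; trivial; apply (HU x H'), H.
Qed.

(** N = (D, ∈, P) has the witness a = k, so V_k has a witness. *)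
Lemma reflect_sentence (p : form) (n : nat) :
  has_order (Datatypes.S n) p -> sentence p -> D k ->
  (forall t x, t <= n -> object (rank_lt k) t x -> D x) ->
  models (rank_structure k U) p ->
  exists a, a ∈ k /\ ~ empty a /\ models (rank_structure a U) p.
Proof.
  intros Hp Hs Hkd Hobj Hsat.
  assert (HN : true_below p D P (env2 (num 0) (num 1))).
  { exists k. split; trivial. split; [exact inaccessible_ordinal |].
    split; [exists (num 0); split; [apply inaccessible_num | exact I] |].
    apply (true_at_iff (fun _ _ => k) Hp Hs); trivial.
    - intros x. split; intros H.
      + apply decode_rank; trivial. exact (decode_mem HD H).
      + apply decode_rank; trivial. apply (proj1 Hel), H.
    - exact decode_pred. }
  apply (elementary_env2 (definable_true_below p) (rank_lt_num 0) (rank_lt_num 1))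
    in HN as (a & Ha & Oa & (y & Hy & _) & H).
  assert (Hak := rank_lt_ordinal inaccessible_ordinal Oa Ha).
  exists a. split; [exact Hak |]. split; [intros He; exact (He y Hy) |].
  intros r. apply (true_at_iff r Hp Hs) in H; trivial.
  - intros x. rewrite (decode_rank_below HS Ha). reflexivity.
  - intros x Hx. apply decode_pred_below. exact (rank_lt_trans Ha Hx).
  - intros t x _. apply rank_lt_object, Hak.
Qed.

End Transfer.

End Inaccessible.

End UniverseOfSets.

Unset Implicit Arguments.

Theorem proposition3p1 (V : membership) (HV : ZFC V) (HL : V_eq_L V)
  (k : V) (Hk : unfoldable k) :
  forall m n : nat, indescribable n m k.
Proof.
  destruct Hk as [Hk Hunf]. intros m n U HU p HPi Hs Hsat.
  destruct (codes_exist HV k U) as [S HS].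
  destruct (form_tags_exist HV Hk) as (T & HT & HTk).
  destruct (rank_set_exists HV k) as [v Hv].
  destruct (objects_exist HV Hv (Datatypes.S n)) as [B HB].
  destruct (constructible_bound HV HL B) as (α & Oα & Hα).
  (* A height β = α + 1 makes α an element of the extension. *)
  destruct (succ_exists HV α) as [β Hβ].
  destruct (Hunf β S (ordinal_succ Oα Hβ)) as (M & Mset & Mwf & Mext & h & Hh & Hβh).
  { intros s H. apply HS, H. }
  assert (Hne : exists a, rank_lt k a) by (exists (num HV 0); exact (rank_lt_num HV Hk 0)).
  destruct (transitive_end_extension HV (@rank_lt_transitive_class V HV k) Hne Mset Mwf Mext)
    as (D & P & HD & Hel & Hheight).
  assert (HBD : forall x, x ∈ B -> D x).
  { assert (HαD : D α) by (apply (Hheight h Hh), Hβh, Hβ; auto).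
    intros x Hx. specialize (Hα x Hx).
    rewrite <- (decode_level Hk HS HT HTk HD Hel HαD) in Hα.
    exact (decode_mem HD Hα). }
  apply (reflect_sentence Hk HS HD Hel (is_Pi_order HPi) Hs); trivial.
  - (* k, as a set of elements of V_k, is an object of type 1. *)
    apply HBD, (HB 1); [lia |]. intros y Hy. exact (rank_lt_mem HV Hy).
  - intros t x Ht Hx. apply HBD, (HB t); [lia | exact Hx].
Qed.
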